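(* Let $s>2$ be a prime power, and let $h_1$ and $h_2$ be two distinct functions in $H(X_1,\dots,X_n)$. The column juxtaposition of $Q_{h_1}(X_1,\dots,X_n)$ and $Q_{h_2}(X_1,\dots,X_n)$ forms an $SSD(s^n,s^m)$ with $m=2(s^n-1)/(s-1)$. It has overall $A_2=s^n-1$ and is optimal under GMA. Furthermore, there are no fully aliased columns if $s$ is odd or $s>4$. (i) For $s$ odd, the possible projected $A_2$ values are $0$, $(s-1)/s$, $(s-1)^2/s^2$ and $(s-1)/s^2$. There are $2s$ pairs with projected $A_2=(s-1)/s$, $s^2$ pairs with projected $A_2=(s-1)^2/s^2$ and $s^2(s^n-s^2)/(s-1)$ pairs with projected $A_2=(s-1)/s^2$. (ii) For $s$ even, the possible projected $A_2$ values are $0,1,2$ and $3$. (iii) For $s=4$, the possible projected $A_2$ values are $0,1$ and $3$. There are one pair of fully aliased columns with projected $A_2=3$ and $4^n-4$ pairs of partially aliased columns with projected $A_2=1$.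
   Context: Designs: $SSD(N,s^m)$ denotes an $N\times m$ matrix $D=[x_{ik}]$ with entries in a set of $s$ symbols (here the finite field $F_s$ with $s$ elements), which is balanced: in every column each symbol appears exactly $N/s$ times. Generalized wordlength pattern: choose orthonormal contrasts on the symbol set, i.e. complex-valued functions $c_1,\dots,c_{s-1}$ on the symbols with $\sum_x c_a(x)=0$ and $\sum_x c_a(x)\overline{c_b(x)}=s$ if $a=b$ and $0$ otherwise. For $j=1,\dots,m$, $$A_j(D)=N^{-2}\sum_{K\subseteq\{1,\dots,m\},\,|K|=j}\ \sum_{(a_k)_{k\in K}\in\{1,\dots,s-1\}^K}\Big|\sum_{i=1}^N\prod_{k\in K}c_{a_k}(x_{ik})\Big|^2 ,$$ independently of the choice of contrasts. The overall $A_2$ is $A_2(D)$; the projected $A_2$ value of a pair of columns is $A_2$ of the two-column design they form. $D$ is optimal under GMA (generalized minimum aberration) if there is no $SSD(N,s^m)$ $D'$ and index $r$ with $A_j(D')=A_j(D)$ for all $j<r$ and $A_r(D')<A_r(D)$. Polynomial columns: a function $f(X_1,\dots,X_n)$ on $F_s^n$ gives a column of length $s^n$, rows being indexed by the points of $F_s^n$; a set of functions gives the design with the corresponding columns. $H(X_1,\dots,X_n)$ is the set of nonzero linear forms $c_1X_1+\cdots+c_nX_n$ ($c_i\in F_s$) whose last nonzero coefficient is $1$. For any variables (independent linear forms) $Y_1,\dots,Y_n$, $Q_1^*(Y_1,\dots,Y_n)=\{Y_1^2+aY_1+g: a\in F_s,\ g\in H(Y_2,\dots,Y_n)\}$ and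 $Q_1(Y_1,\dots,Y_n)=\{Y_1\}\cup Q_1^*(Y_1,\dots,Y_n)$, where $H(Y_2,\dots,Y_n)$ is the set of nonzero linear forms in $Y_2,\dots,Y_n$ whose last nonzero coefficient is $1$. For $h=c_1X_1+\cdots+c_nX_n\in H(X_1,\dots,X_n)$, let $k$ be the largest index with $c_k\ne0$ (so $c_k=1$), put $Y_1=h$, $Y_i=X_{i-1}$ for $2\le i\le k$, $Y_i=X_i$ for $k<i\le n$, and define $Q_h(X_1,\dots,X_n)=Q_1(Y_1,\dots,Y_n)$ (as functions on $F_s^n$ in $X_1,\dots,X_n$). Two columns of length $s^n$ are fully aliased if the pair has only $s$ distinct level combinations, each occurring $s^{n-1}$ times (equivalently projected $A_2=s-1$); orthogonal if it has $s^2$ distinct level combinations, each occurring $s^{n-2}$ times (projected $A_2=0$); partially aliased if neither orthogonal nor fully aliased. *)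

(* Defs.v *)
From mathcomp Require Import all_boot all_order all_algebra.

Set Implicit Arguments.
Unset Strict Implicit.
Unset Printing Implicit Defensive.

Import Order.TTheory GRing.Theory Num.Theory.
Local Open Scope ring_scope.

Section Designs.

Variable S : finType.

(* Balance is written multiplicatively, so that it entails #|S| %| N as soon as
   there is at least one column. *)
Definition balanced (N m : nat) (D : 'M[S]_(N, m)) : Prop :=
  forall (k : 'I_m) (x : S), (#|[set i | D i k == x]| * #|S|)%N = N.

(* SSD(N, s^m); the dimensions are compared propositionally because those of a
   concrete design are usually cardinals of finite types. *)
Definition is_SSD (N0 m0 : nat) (D : 'M[S]_(N0, m0)) (N s m : nat) : Prop :=
  [/\ N0 = N, m0 = m, #|S| = s & balanced D].

Definition level_count (N m : nat) (D : 'M[S]_(N, m)) (k l : 'I_m)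
    (xy : S * S) : nat :=
  #|[set i | (D i k == xy.1) && (D i l == xy.2)]|.

Definition level_combinations (N m : nat) (D : 'M[S]_(N, m)) (k l : 'I_m)
    : {set S * S} :=
  [set xy | (0 < level_count D k l xy)%N].

(* Exactly t distinct level combinations, each occurring N / t times; for
   N = s ^ n this is s ^ (n - 1) when t = s and s ^ (n - 2) when t = s ^ 2. *)
Definition uniform_levels (t N m : nat) (D : 'M[S]_(N, m)) (k l : 'I_m) : bool :=
  (#|level_combinations D k l| == t) &&
  [forall xy in level_combinations D k l, (level_count D k l xy * t == N)%N].

Definition fully_aliased (N m : nat) (D : 'M[S]_(N, m)) (k l : 'I_m) : bool :=
  uniform_levels #|S| D k l.

Definition orthogonal_columns (N m : nat) (D : 'M[S]_(N, m)) (k l : 'I_m)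
    : bool :=
  uniform_levels (#|S| ^ 2) D k l.

Definition partially_aliased (N m : nat) (D : 'M[S]_(N, m)) (k l : 'I_m)
    : bool :=
  ~~ orthogonal_columns D k l && ~~ fully_aliased D k l.

(* Unordered pairs of distinct columns, listed as (k, l) with k < l. *)
Definition num_pairs (m : nat) (P : 'I_m -> 'I_m -> bool) : nat :=
  #|[set p : 'I_m * 'I_m | (p.1 < p.2)%N && P p.1 p.2]|.

(* C plays the role of the complex numbers. *)
Variable C : numClosedFieldType.

Definition orthonormal_contrasts (c : 'I_#|S|.-1 -> S -> C) : Prop :=
  (forall a, \sum_(x : S) c a x = 0) /\
  (forall a b, \sum_(x : S) c a x * (c b x)^* = if a == b then #|S|%:R else 0).

Variable c : 'I_#|S|.-1 -> S -> C.

Definition gwlp (N m : nat) (D : 'M[S]_(N, m)) (j : nat) : C :=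
  N%:R ^- 2 *
  \sum_(K : {set 'I_m} | #|K| == j)
    \sum_(a : {ffun {k : 'I_m | k \in K} -> 'I_#|S|.-1})
      `| \sum_(i < N) \prod_(k : {k : 'I_m | k \in K}) c (a k) (D i (val k)) |
      ^+ 2.

Definition projected_A2 (N m : nat) (D : 'M[S]_(N, m)) (k l : 'I_m) : C :=
  gwlp (row_mx (col k D) (col l D)) 2.

(* The order of C is partial, but the values of gwlp are nonnegative reals. *)
Definition GMA_optimal (N m : nat) (D : 'M[S]_(N, m)) : Prop :=
  ~ exists (D' : 'M[S]_(N, m)) (r : nat),
      [/\ balanced D', (0 < r <= m)%N,
          forall j : nat, (0 < j < r)%N -> gwlp D' j = gwlp D j
        & gwlp D' r < gwlp D r].

End Designs.

Section PolynomialDesigns.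

Variable F : finFieldType.

(* A linear form c_1 X_1 + ... + c_n X_n is represented by its coefficient row
   (c_1, ..., c_n), and a finite family of linear forms by the matrix whose rows
   are its members. *)
Definition lin_form (n : nat) (h x : 'rV[F]_n) : F :=
  \sum_(i < n) h 0 i * x 0 i.

Definition last_nonzero (n : nat) (h : 'rV[F]_n) (k : 'I_n) : bool :=
  (h 0 k != 0) && [forall j : 'I_n, (k < j)%N ==> (h 0 j == 0)].

(* H(Y_1, ..., Y_r) is the set of the linear combinations of the Y_i whose last
   nonzero coefficient is 1. *)
Definition H_forms (r n : nat) (Y : 'M[F]_(r, n)) : {set 'rV[F]_n} :=
  [set d *m Y | d : 'rV[F]_r & [exists k, last_nonzero d k && (d 0 k == 1)]].

(* Y collects the variables Y_2, ..., Y_n. *)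
Definition Q1star (r n : nat) (Y1 : 'rV[F]_n) (Y : 'M[F]_(r, n))
    : {set {ffun 'rV[F]_n -> F}} :=
  [set [ffun x => lin_form Y1 x ^+ 2 + a * lin_form Y1 x + lin_form g x]
    | a : F, g : 'rV[F]_n in H_forms Y].

Definition Q1 (r n : nat) (Y1 : 'rV[F]_n) (Y : 'M[F]_(r, n))
    : {set {ffun 'rV[F]_n -> F}} :=
  [ffun x => lin_form Y1 x] |: Q1star Y1 Y.

(* The rows of row' k 1%:M are X_1, ..., X_n with X_k left out, in this order.
   The default value is only met for h = 0. *)
Definition Q_of (n : nat) (h : 'rV[F]_n) : {set {ffun 'rV[F]_n -> F}} :=
  if [pick k | last_nonzero h k] is Some k then Q1 h (row' k 1%:M) else set0.

Definition poly_design (n : nat) (A : {set {ffun 'rV[F]_n -> F}})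
    : 'M[F]_(#|{: 'rV[F]_n}|, #|A|) :=
  \matrix_(i, k) (enum_val k : {ffun 'rV[F]_n -> F}) (enum_val i).

End PolynomialDesigns.

(* Main.v *)
Require Import Defs.
From HB Require Import structures.
From mathcomp Require Import all_boot all_order all_algebra all_field.
From mathcomp Require Import ring zify.
Set Implicit Arguments.
Unset Strict Implicit.
Unset Printing Implicit Defensive.
Import Order.TTheory GRing.Theory Num.Theory.
Local Open Scope ring_scope.

(** Write s = #|F| and N = s ^ n, the number of points of F^n.

    Expanding the squared modulus in A_j and summing over the contrasts turns
    A_j into N^-2 times the sum over all pairs of rows of the j-th elementary
    symmetric function of the m numbers s [D i k = D i' k] - 1.  Hence the whole
    wordlength pattern depends only on the coincidence numbers of the pairs of
    rows, that is on the number of columns in which two rows agree ([gwlp_coin]);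
    A_1 vanishes for balanced designs, and A_2 is an increasing affine function
    of the sum of the squared coincidence numbers ([gwlp2_coin]).  The sum of
    the coincidence numbers is fixed by balance, so by Cauchy-Schwarz a design
    in which any two distinct rows have the same number of coincidences
    minimizes A_2, and any other minimizer has the same coincidence numbers and
    therefore the same pattern: it is optimal under GMA ([equidistant_GMA]).

    The (N - 1) / (s - 1) columns of Q_h are balanced and pairwise orthogonal,
    and a design with these properties is equidistant: the variance of the
    coincidence numbers vanishes ([saturated_equidistant]).  Juxtaposing two
    such designs gives an equidistant design again, whence the value of A_2 and
    the optimality.

    The projected A_2 of two balanced columns f1, f2 is s^2 M / N^2 - 1, where M
    is the number of pairs of points that the map (f1, f2) does not separate
    ([projected_A2E]); it is 0 exactly for orthogonal and s - 1 exactly for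
    fully aliased columns.  For f1 in Q_h1 and f2 in Q_h2 let Z be the common
    kernel of h1 and h2.  The columns h1 and h2 are orthogonal, and so are f1 and
    f2 if a translation along Z shifts one of them and fixes the other.
    Otherwise, writing g1 and g2 for the linear parts, M reduces to the number
    of collisions of an explicit quadratic map on the plane F^2 with coordinates
    h1, h2: [plane1] if one column is the form h1 or h2, [plane2] if g1 and g2
    vanish on Z, and [plane3] if they are proportional and nonzero on Z
    ([cross_cases]).  When s is odd,
    f (x + w) = f x is for fixed w an affine equation in x, and the collisions
    are counted exactly.  When s is even the maps are additive, so M is N times
    the size of a kernel; for [plane2] this kernel is the set of roots of an
    additive quartic and has 1, 2 or 4 elements.

    Exactly one of the admissible g1 and one of the admissible g2 vanish on Z
    ([special_exists], [special_uniq]), which counts the pairs of the first two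
    kinds.  The number of pairs of the last kind follows
    from the total A_2 = N - 1, the sum of all projected values. *)

(** * Sums over pairs of columns *)

Section CardTwo.

Variables (R : nmodType) (m : nat).

Lemma sum_card2 (G : {set 'I_m} -> R) :
  \sum_(K : {set 'I_m} | #|K| == 2) G K =
  \sum_(p : 'I_m * 'I_m | (p.1 < p.2)%N) G [set p.1; p.2].
Proof.
pose h (p : 'I_m * 'I_m) := [set p.1; p.2].
pose A := [set p : 'I_m * 'I_m | (p.1 < p.2)%N].
rewrite (eq_bigl (fun K : {set 'I_m} => K \in h @: A)); last first.
  move=> K; apply/idP/imsetP => [/cards2P[x [y [nxy ->]]]|[p]].
    case: (ltngtP x y) => [lt|gt|/val_inj e]; last by rewrite e eqxx in nxy.
      by exists (x, y); rewrite ?inE.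
    by exists (y, x); rewrite ?inE // /h /= setUC.
  rewrite inE => lt ->; rewrite cards2.
  by have -> : p.1 != p.2 by apply: contraTneq lt => ->; rewrite ltnn.
rewrite big_imset; first by apply: eq_bigl => p; rewrite inE.
move=> [x y] [z t]; rewrite !inE /= => lt1 lt2 /setP e.
have := e x; have := e y; rewrite !inE !eqxx orbT /=.
move=> /esym/orP[]/eqP ey /esym/orP[]/eqP ex; subst => //.
- by rewrite ltnn in lt1.
- by have := ltn_trans lt1 lt2; rewrite ltnn.
by rewrite ltnn in lt1.
Qed.

Lemma sum_pairs_double (G : 'I_m -> 'I_m -> R) :
  (forall k l, G k l = G l k) ->
  \sum_k \sum_l G k l =
  (\sum_(p : 'I_m * 'I_m | (p.1 < p.2)%N) G p.1 p.2) *+ 2 + \sum_k G k k.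
Proof.
move=> sG; rewrite pair_bigA /= (bigID (fun p : 'I_m * 'I_m => (p.1 < p.2)%N)) /=.
rewrite mulr2n -addrA; congr (_ + _).
rewrite (bigID (fun p : 'I_m * 'I_m => (p.2 < p.1)%N)) /=; congr (_ + _).
  rewrite (reindex_inj (h := fun p : 'I_m * 'I_m => (p.2, p.1))) /=; last first.
    by move=> [a b] [c d] [-> ->].
  apply: eq_big => [p|p _]; last exact: sG.
  by rewrite -leqNgt andb_idl // => /ltnW.
rewrite (eq_bigl (fun p : 'I_m * 'I_m => (true && (p.1 == p.2)))); last first.
  by move=> p /=; rewrite -!leqNgt -eqn_leq eq_sym.
rewrite -(pair_big_dep xpredT (fun i j => i == j) G) /=.
by apply: eq_bigr => k _; rewrite (big_pred1 k) // => l; rewrite eq_sym.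
Qed.

End CardTwo.

(** * Coincidences of rows and collisions of functions *)

Section Coincidences.

Variables (S : finType).

(** The coincidence number of the rows i and j: the number of columns in which
    they agree. *)
Definition coin (N m : nat) (D : 'M[S]_(N, m)) (i j : 'I_N) : nat :=
  #|[set k | D i k == D j k]|.

(** The number of collisions of f: of the ordered pairs of points, equal points
    included, at which f takes the same value. *)
Definition coll (T : finType) (U : eqType) (f : T -> U) : nat :=
  #|[set p : T * T | f p.1 == f p.2]|.

(** The collisions of the row map that reads the columns k and l. *)
Definition col_coll (N m : nat) (D : 'M[S]_(N, m)) (k l : 'I_m) : nat :=
  coll (fun i => (D i k, D i l)).

End Coincidences.

Lemma coll_fibers (T : finType) (U : finType) (f : T -> U) :
  coll f = (\sum_(v : U) #|[set x | f x == v]| ^ 2)%N.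
Proof.
rewrite /coll -sum1dep_card -(pair_big_dep xpredT (fun x y => f x == f y) (fun _ _ => 1%N)) /=.
rewrite (partition_big f xpredT) //=; apply: eq_bigr => v _.
transitivity (\sum_(i | f i == v) #|[set x | f x == v]|)%N.
  apply: eq_bigr => i /eqP <-; rewrite sum1dep_card.
  by apply: eq_card => x; rewrite !inE eq_sym.
by rewrite sum_nat_const expnS expn1 cardsE.
Qed.

Lemma nat_of_bool_sum (R : pzSemiRingType) (T : finType) (P : pred T) :
  \sum_(x : T) (P x)%:R = #|[set x | P x]|%:R :> R.
Proof.
rewrite -sum1dep_card natr_sum [RHS]big_mkcond /=.
by apply: eq_bigr => x _; case: (P x).
Qed.

Section Moments.

Variables (R : comPzRingType) (S : finType) (N m : nat) (D : 'M[S]_(N, m)).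

Lemma coinE i j : (coin D i j)%:R = \sum_k (D i k == D j k)%:R :> R.
Proof. by rewrite nat_of_bool_sum. Qed.

Lemma coin_diag i : coin D i i = m.
Proof.
by rewrite /coin -[RHS]card_ord -cardsT; apply: eq_card => k; rewrite !inE eqxx.
Qed.

Lemma col_collE k l :
  (col_coll D k l)%:R =
  \sum_i \sum_j (D i k == D j k)%:R * (D i l == D j l)%:R :> R.
Proof.
rewrite /col_coll /coll -nat_of_bool_sum pair_bigA /=.
by apply: eq_bigr => p _; rewrite -natrM mulnb -xpair_eqE.
Qed.

Lemma sum_coin_sq :
  \sum_i \sum_j (coin D i j)%:R ^+ 2 = \sum_k \sum_l (col_coll D k l)%:R :> R.
Proof.
under [RHS]eq_bigr => k _.
  under eq_bigr => l _ do rewrite col_collE.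
  rewrite exchange_big /=.
  under eq_bigr => i _ do rewrite exchange_big /=.
  over.
rewrite [RHS]exchange_big; apply: eq_bigr => i _ /=.
rewrite [RHS]exchange_big; apply: eq_bigr => j _ /=.
rewrite expr2 coinE mulr_suml; apply: eq_bigr => k _.
by rewrite mulr_sumr.
Qed.

Lemma col_coll_diag k :
  (col_coll D k k)%:R = \sum_i \sum_j (D i k == D j k)%:R :> R.
Proof.
rewrite col_collE; apply: eq_bigr => i _; apply: eq_bigr => j _.
by rewrite -natrM mulnb andbb.
Qed.

Lemma sum_coin : \sum_i \sum_j (coin D i j)%:R = \sum_k (col_coll D k k)%:R :> R.
Proof.
under [RHS]eq_bigr => k _ do rewrite col_coll_diag.
rewrite [RHS]exchange_big; apply: eq_bigr => i _ /=.
rewrite [RHS]exchange_big; apply: eq_bigr => j _ /=.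
exact: coinE.
Qed.

Lemma balanced_coll k :
  balanced D -> (col_coll D k k * #|S| = N ^ 2)%N.
Proof.
move=> bD; have -> : col_coll D k k = coll (fun i => D i k).
  by apply: eq_card => p; rewrite !inE xpair_eqE andbb.
rewrite coll_fibers big_distrl /=.
transitivity (\sum_(v : S) #|[set i | D i k == v]| * N)%N.
  by apply: eq_bigr => v _; rewrite expnS expn1 -mulnA bD.
rewrite -(big_distrl N) /= expnS expn1; congr (_ * _)%N.
rewrite -[RHS]card_ord -[RHS]sum1_card [RHS](partition_big (fun i => D i k) xpredT) //=.
by apply: eq_bigr => v _; rewrite sum1dep_card.
Qed.

End Moments.

(** * The wordlength pattern in terms of coincidences *)

Section Contrasts.

Variables (S : finType) (C : numClosedFieldType) (c : 'I_#|S|.-1 -> S -> C).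
Hypothesis cP : orthonormal_contrasts c.

(** Together with the constant function the contrasts form an orthogonal basis;
    this is the dual orthogonality relation. *)
Lemma contrasts_dual x y :
  \sum_a c a x * (c a y)^* = #|S|%:R * (x == y)%:R - 1.
Proof.
have S_gt0 : (0 < #|S|)%N by apply/card_gt0P; exists x.
have e := prednK S_gt0; have [c0 c1] := cP.
pose pt (j : 'I_(#|S|.-1.+1)) : S := enum_val (cast_ord e j).
pose rk (z : S) : 'I_(#|S|.-1.+1) := cast_ord (esym e) (enum_rank z).
have rkK : cancel rk pt by move=> z; rewrite /pt /rk cast_ordKV enum_rankK.
have ptK : cancel pt rk by move=> z; rewrite /pt /rk enum_valK cast_ordK.
have ptB : bijective pt by exists rk.
pose B : 'M[C]_(#|S|.-1.+1) :=
  \matrix_(i, j) oapp (fun a => c a (pt j)) 1 (unlift ord0 i).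
pose B' : 'M[C]_(#|S|.-1.+1) := \matrix_(i, j) (#|S|%:R^-1 * (B j i)^* ).
have s0 : #|S|%:R != 0 :> C by rewrite pnatr_eq0 -lt0n.
(* The rows of B are the constant 1 and the contrasts, so orthonormality says
   that B' is its right inverse; the claim is that it is also a left inverse. *)
have BB : B *m B' = 1%:M.
  apply/matrixP => i j; rewrite !mxE.
  transitivity (#|S|%:R^-1 *
      \sum_z (oapp (fun a => c a z) 1 (unlift ord0 i))
        * (oapp (fun a => c a z) 1 (unlift ord0 j))^* ).
    rewrite mulr_sumr (reindex pt) /=; last exact: onW_bij.
    by apply: eq_bigr => z _; rewrite !mxE mulrCA.
  case: unliftP => [a ->|->]; case: unliftP => [b ->|->] /=.
  - rewrite c1 (inj_eq lift_inj); case: eqP => _; rewrite ?mulr0 //.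
    by rewrite mulVf.
  - rewrite rmorph1 (eq_bigr (c a)) ?c0 ?mulr0 // => z _; exact: mulr1.
  - have := congr1 Num.conj (c0 b); rewrite rmorph_sum rmorph0 /= => cb.
    rewrite (eq_bigr (fun z => (c b z)^* )) ?cb ?mulr0 // => z _; exact: mul1r.
  rewrite rmorph1 (eq_bigr (fun _ => 1)) => [|z _]; last exact: mulr1.
  by rewrite sumr_const mulVf.
have /matrixP/(_ (rk y) (rk x)) := mulmx1C BB; rewrite !mxE.
rewrite (inj_eq (can_inj rkK)) big_ord_recl !mxE unlift_none /= rmorph1 => E.
apply: (mulfI (invr_neq0 s0)); rewrite mulrBr mulrA mulVf // mul1r mulr1.
rewrite eq_sym -[X in _ = X - _]E !mulr1 addrAC subrr add0r mulr_sumr.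
apply: eq_bigr => a _; rewrite !mxE liftK /= !rkK.
by rewrite -mulrA; congr (_ * _); rewrite mulrC.
Qed.

(** The sum over all contrasts of c (D i k) times the conjugate of c (D j k). *)
Definition kern (N m : nat) (D : 'M[S]_(N, m)) i j k : C :=
  #|S|%:R * (D i k == D j k)%:R - 1.

Lemma gwlpE (N m : nat) (D : 'M[S]_(N, m)) (t : nat) :
  gwlp c D t = N%:R ^- 2 * \sum_i \sum_j
    \sum_(K : {set 'I_m} | #|K| == t) \prod_(k in K) kern D i j k.
Proof.
rewrite /gwlp; congr (_ * _).
under [RHS]eq_bigr => i _ do rewrite exchange_big /=.
rewrite [RHS]exchange_big; apply: eq_bigr => K _ /=.
transitivity (\sum_(a : {ffun {k | k \in K} -> 'I_#|S|.-1}) \sum_i \sum_j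
    \prod_(k : {k : 'I_m | k \in K})
      (c (a k) (D i (val k)) * (c (a k) (D j (val k)))^* )).
  apply: eq_bigr => a _; rewrite normCK rmorph_sum /= mulr_suml.
  apply: eq_bigr => i _; rewrite mulr_sumr; apply: eq_bigr => j _.
  by rewrite rmorph_prod -big_split.
rewrite exchange_big; apply: eq_bigr => i _ /=.
rewrite exchange_big; apply: eq_bigr => j _ /=.
rewrite -(bigA_distr_bigA (fun (k : {k | k \in K}) a =>
   c a (D i (val k)) * (c a (D j (val k)))^* )) /=.
rewrite [RHS](reindex_omap (val : {k | k \in K} -> 'I_m) insub) /=; last first.
  by move=> k kK; rewrite insubT.
apply: eq_big => [k|k _]; last exact: contrasts_dual.
by rewrite valK eqxx andbT; rewrite (valP k).
Qed.

End Contrasts.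

Section Gwlp.

Variables (S : finType) (C : numClosedFieldType) (c : 'I_#|S|.-1 -> S -> C).
Hypothesis cP : orthonormal_contrasts c.
Local Notation s := (#|S|%:R : C).

(** The elementary symmetric functions of the kern i j k, over k, are the
    coefficients of the product of the 1 + kern i j k 'X.  As kern i j k is
    s - 1 or -1, the product only depends on the coincidence number. *)
Lemma elementary_kern (N m : nat) (D : 'M[S]_(N, m)) i j t :
  \sum_(K : {set 'I_m} | #|K| == t) \prod_(k in K) kern C D i j k =
  ((1 + (s - 1) *: 'X) ^+ coin D i j * (1 - 'X) ^+ (m - coin D i j))`_t.
Proof.
have -> : (1 + (s - 1) *: 'X) ^+ coin D i j * (1 - 'X) ^+ (m - coin D i j)
    = \prod_k ((kern C D i j k) *: 'X + 1) :> {poly C}.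
  rewrite [RHS](bigID (fun k => D i k == D j k)) /=; congr (_ * _).
    rewrite (eq_bigr (fun _ => 1 + (s - 1) *: 'X)) => [|k /eqP e].
      by rewrite prodr_const /coin cardsE.
    by rewrite /kern e eqxx mulr1 addrC.
  rewrite (eq_bigr (fun _ => 1 - 'X)) => [|k /negbTE e].
    rewrite prodr_const; congr (_ ^+ _).
    have := cardsC [set k | D i k == D j k]; rewrite card_ord => {1}<-.
    by rewrite addKn; apply: eq_card => k; rewrite !inE.
  by rewrite /kern e mulr0 sub0r scaleN1r addrC.
rewrite bigA_distr coef_sum [LHS]big_mkcond /=; apply: eq_big => // K _.
rewrite -big_mkcond /= scaler_prod prodr_const coefZ coefXn [t == _]eq_sym.
by case: (_ == t); rewrite ?mulr1 ?mulr0.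
Qed.

Lemma gwlp_coin (N m : nat) (D D' : 'M[S]_(N, m)) t :
  (forall i j, coin D i j = coin D' i j) -> gwlp c D t = gwlp c D' t.
Proof.
move=> e; rewrite !gwlpE //; congr (_ * _); apply: eq_bigr => i _.
by apply: eq_bigr => j _; rewrite !elementary_kern e.
Qed.

Lemma sum_kern (N m : nat) (D : 'M[S]_(N, m)) i j :
  \sum_k kern C D i j k = s * (coin D i j)%:R - m%:R.
Proof.
by rewrite /kern sumrB sumr_const card_ord coinE mulr_sumr.
Qed.

Lemma sum_kern_sq (N m : nat) (D : 'M[S]_(N, m)) i j :
  \sum_k kern C D i j k ^+ 2 = (s ^+ 2 - 2 * s) * (coin D i j)%:R + m%:R.
Proof.
transitivity (\sum_k ((s ^+ 2 - 2 * s) * (D i k == D j k)%:R + 1)).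
  by apply: eq_bigr => k _; rewrite /kern; case: eqP => _ /=; ring.
by rewrite big_split /= sumr_const card_ord coinE mulr_sumr.
Qed.

Lemma gwlp2_pairs (N m : nat) (D : 'M[S]_(N, m)) :
  gwlp c D 2 =
  N%:R ^- 2 * \sum_(p : 'I_m * 'I_m | (p.1 < p.2)%N)
                \sum_i \sum_j kern C D i j p.1 * kern C D i j p.2.
Proof.
rewrite gwlpE //; congr (_ * _).
under eq_bigr => i _ do rewrite exchange_big /=.
rewrite exchange_big sum_card2 /=; apply: eq_bigr => -[k l] /= lt.
have nkl : k != l by apply: contraTneq lt => ->; rewrite ltnn.
apply: eq_bigr => i _; apply: eq_bigr => j _.
by rewrite big_setU1 ?inE //= big_set1.
Qed.

Lemma projected_A2_kern (N m : nat) (D : 'M[S]_(N, m)) k l :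
  projected_A2 c D k l =
  N%:R ^- 2 * \sum_i \sum_j kern C D i j k * kern C D i j l.
Proof.
rewrite /projected_A2 gwlp2_pairs; congr (_ * _).
rewrite (big_pred1 (lshift 1 ord0, rshift 1 ord0)) /=; last first.
  case=> a b; rewrite /= xpair_eqE.
  by case: (split_ordP a) => a' ->; case: (split_ordP b) => b' ->;
     rewrite ?(ord1 a') ?(ord1 b').
apply: eq_bigr => i _; apply: eq_bigr => j _.
by rewrite /kern !row_mxEl !row_mxEr !mxE.
Qed.

Lemma gwlp2_sum (N m : nat) (D : 'M[S]_(N, m)) :
  gwlp c D 2 =
  \sum_(p : 'I_m * 'I_m | (p.1 < p.2)%N) projected_A2 c D p.1 p.2.
Proof.
rewrite gwlp2_pairs mulr_sumr; apply: eq_bigr => p _.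
by rewrite projected_A2_kern.
Qed.

Lemma projected_A2C (N m : nat) (D : 'M[S]_(N, m)) k l :
  projected_A2 c D k l = projected_A2 c D l k.
Proof.
rewrite !projected_A2_kern; congr (_ * _).
by apply: eq_bigr => i _; apply: eq_bigr => j _; rewrite mulrC.
Qed.

Section Balanced.

Variables (N m : nat) (D : 'M[S]_(N, m)).
Hypotheses (N_gt0 : (0 < N)%N) (S_gt0 : (0 < #|S|)%N) (bD : balanced D).

Let s0 : s != 0. Proof. by rewrite pnatr_eq0 -lt0n. Qed.
Let N0 : N%:R != 0 :> C. Proof. by rewrite pnatr_eq0 -lt0n. Qed.

Lemma col_coll_bal k : (col_coll D k k)%:R = N%:R ^+ 2 / s :> C.
Proof.
by rewrite -natrX -(balanced_coll k bD) natrM mulfK.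
Qed.

Lemma projected_A2E k l :
  projected_A2 c D k l = s ^+ 2 * (col_coll D k l)%:R / N%:R ^+ 2 - 1.
Proof.
rewrite projected_A2_kern.
have -> : \sum_i \sum_j kern C D i j k * kern C D i j l =
   s ^+ 2 * (col_coll D k l)%:R - s * (col_coll D k k)%:R
    - s * (col_coll D l l)%:R + N%:R ^+ 2.
  rewrite col_collE !col_coll_diag !mulr_sumr -!sumrB.
  have -> : N%:R ^+ 2 = \sum_(i < N) \sum_(j < N) 1 :> C.
    by rewrite !sumr_const !card_ord -mulrnA mulnn natrX.
  rewrite -big_split; apply: eq_bigr => i _ /=.
  rewrite !mulr_sumr -!sumrB -big_split; apply: eq_bigr => j _ /=.
  by rewrite /kern; ring.
by rewrite !col_coll_bal; field; rewrite s0 N0.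
Qed.

Lemma sum_coin_bal :
  \sum_i \sum_j (coin D i j)%:R = m%:R * N%:R ^+ 2 / s :> C.
Proof.
rewrite sum_coin (eq_bigr (fun _ => N%:R ^+ 2 / s)) => [|k _].
  by rewrite sumr_const card_ord -[LHS]mulr_natl mulrA.
exact: col_coll_bal.
Qed.

Lemma gwlp1_bal : gwlp c D 1 = 0.
Proof.
rewrite gwlpE // (_ : \sum_i _ = 0) ?mulr0 //.
transitivity (\sum_i \sum_j (s * (coin D i j)%:R - m%:R)).
  apply: eq_bigr => i _; apply: eq_bigr => j _; rewrite -sum_kern.
  rewrite (eq_bigl (fun K : {set 'I_m} => K \in (fun k : 'I_m => [set k]) @: setT)).
    rewrite big_imset => [|k l _ _]; last exact: set1_inj.
    by apply: eq_big => [k|k _]; rewrite ?inE // big_set1.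
  move=> K; apply/cards1P/imsetP => [[k ->]|[k _ ->]]; last by exists k.
  by exists k; rewrite ?inE.
under eq_bigr => i _ do rewrite sumrB sumr_const card_ord -mulr_sumr.
rewrite sumrB sumr_const card_ord -mulr_sumr sum_coin_bal -!mulrnA.
by rewrite -mulr_natr natrM; field.
Qed.

(** Over balanced designs A_2 is governed by the second moment of the coincidence
    numbers alone. *)
Lemma gwlp2_coin :
  gwlp c D 2 = (s ^+ 2 * \sum_i \sum_j (coin D i j)%:R ^+ 2) / (2 * N%:R ^+ 2)
     - (m%:R ^+ 2 + m%:R * (s - 1)) / 2.
Proof.
have E : \sum_i \sum_j ((\sum_k kern C D i j k) ^+ 2 - \sum_k kern C D i j k ^+ 2)
   = (N%:R ^+ 2 * gwlp c D 2) *+ 2.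
  rewrite gwlp2_pairs mulrA mulfV ?expf_neq0 // mul1r.
  rewrite [in RHS]exchange_big -sumrMnl; apply: eq_bigr => i _ /=.
  rewrite [in RHS]exchange_big -sumrMnl; apply: eq_bigr => j _ /=.
  rewrite expr2 mulr_suml.
  under [X in X - _]eq_bigr => k _ do rewrite mulr_sumr.
  rewrite sum_pairs_double => [|k l]; last exact: mulrC.
  by rewrite addrK.
have {E} : \sum_i \sum_j (s ^+ 2 * (coin D i j)%:R ^+ 2
      - (2 * s * m%:R + s ^+ 2 - 2 * s) * (coin D i j)%:R + (m%:R ^+ 2 - m%:R))
   = (N%:R ^+ 2 * gwlp c D 2) *+ 2.
  rewrite -E; apply: eq_bigr => i _; apply: eq_bigr => j _.
  by rewrite sum_kern sum_kern_sq; ring.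
have -> : \sum_i \sum_j (s ^+ 2 * (coin D i j)%:R ^+ 2
      - (2 * s * m%:R + s ^+ 2 - 2 * s) * (coin D i j)%:R + (m%:R ^+ 2 - m%:R)) =
   s ^+ 2 * (\sum_i \sum_j (coin D i j)%:R ^+ 2) -
   (2 * s * m%:R + s ^+ 2 - 2 * s) * (\sum_i \sum_j (coin D i j)%:R)
   + N%:R ^+ 2 * (m%:R ^+ 2 - m%:R).
  have -> : N%:R ^+ 2 * (m%:R ^+ 2 - m%:R)
     = \sum_(i < N) \sum_(j < N) (m%:R ^+ 2 - m%:R) :> C.
    by rewrite !sumr_const !card_ord -mulrnA -[RHS]mulr_natl natrM expr2.
  rewrite !mulr_sumr -sumrB -big_split; apply: eq_bigr => i _ /=.
  by rewrite !mulr_sumr -sumrB -big_split.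
rewrite sum_coin_bal => E.
have N2 : 2 * N%:R ^+ 2 != 0 :> C by rewrite mulf_neq0 ?expf_neq0 // pnatr_eq0.
apply: (mulfI N2); rewrite -[LHS]mulrA [LHS]mulr_natl -E.
by field; rewrite s0 N0.
Qed.

End Balanced.

End Gwlp.

(** * Equidistant designs *)

Section Optimality.

Variables (S : finType) (C : numClosedFieldType) (c : 'I_#|S|.-1 -> S -> C).
Hypothesis cP : orthonormal_contrasts c.
Local Notation s := (#|S|%:R : C).

(** A balanced design all of whose pairs of distinct rows have the same number d
    of coincidences is optimal under GMA. *)
Lemma equidistant_GMA (N m d : nat) (D : 'M[S]_(N, m)) :
  (0 < N)%N -> (0 < #|S|)%N -> balanced D ->
  (forall i j, i != j -> coin D i j = d) ->
  GMA_optimal c D.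
Proof.
move=> N_gt0 S_gt0 bD Dd [D' [r [bD' /andP[r_gt0 r_le] eqA ltA]]].
have coef_gt0 : 0 < #|S|%:R ^+ 2 / (2 * N%:R ^+ 2) :> C.
  by rewrite divr_gt0 ?exprn_gt0 ?mulr_gt0 ?exprn_gt0 ?ltr0n.
pose del i j : C := (coin D' i j)%:R - (coin D i j)%:R.
(* The deviation del has sum zero and vanishes on the diagonal, so it is
   orthogonal to coin D, which is constant off the diagonal. *)
have del_sum : \sum_i \sum_j del i j = 0.
  rewrite /del; under eq_bigr => i _ do rewrite sumrB.
  by rewrite sumrB !(sum_coin_bal C S_gt0) // subrr.
have del_diag i : del i i = 0 by rewrite /del !coin_diag subrr.
have cross : \sum_i \sum_j (coin D i j)%:R * del i j = 0.
  transitivity (d%:R * \sum_i \sum_j del i j); last by rewrite del_sum mulr0.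
  rewrite mulr_sumr; apply: eq_bigr => i _.
  rewrite mulr_sumr; apply: eq_bigr => j _.
  by have [->|/Dd->] := eqVneq i j; rewrite ?del_diag ?mulr0.
have sq : \sum_i \sum_j (coin D' i j)%:R ^+ 2 =
    \sum_i \sum_j (coin D i j)%:R ^+ 2 + \sum_i \sum_j del i j ^+ 2.
  transitivity (\sum_i \sum_j (coin D i j)%:R ^+ 2 + \sum_i \sum_j del i j ^+ 2
      + 2 * \sum_i \sum_j (coin D i j)%:R * del i j); last by rewrite cross mulr0 addr0.
  rewrite mulr_sumr -!big_split.
  apply: eq_bigr => i _ /=; rewrite mulr_sumr -!big_split; apply: eq_bigr => j _ /=.
  by rewrite /del; ring.
have A2E : gwlp c D' 2 = gwlp c D 2
    + #|S|%:R ^+ 2 / (2 * N%:R ^+ 2) * \sum_i \sum_j del i j ^+ 2.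
  by rewrite !gwlp2_coin // sq; ring.
have del_real i j : del i j \is Num.real by rewrite rpredB ?realn.
have del_ge0 : 0 <= \sum_i \sum_j del i j ^+ 2.
  by apply: sumr_ge0 => i _; apply: sumr_ge0 => j _; rewrite real_exprn_even_ge0.
case: r r_gt0 r_le eqA ltA => [//|[|[|r]]] _ r_le eqA ltA.
- by rewrite !gwlp1_bal // ltxx in ltA.
- by move: ltA; rewrite A2E gtrDl pmulr_rlt0 // le_gtF.
(* For r at least 3 the equality of the A_2 values forces del = 0, hence the
   equality of the two patterns. *)
have /eqP := eqA 2%N isT; rewrite A2E -subr_eq0 addrC addKr mulf_eq0 gt_eqF //=.
rewrite psumr_eq0 => [/allP del0|i _]; last first.
  by apply: sumr_ge0 => j _; rewrite real_exprn_even_ge0.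
suff coinDD' i j : coin D' i j = coin D i j.
  by rewrite (gwlp_coin cP r.+3 coinDD') ltxx in ltA.
have := del0 i (mem_index_enum i); rewrite /= psumr_eq0 => [/allP|k _]; last first.
  by rewrite real_exprn_even_ge0.
move=> /(_ j (mem_index_enum j)); rewrite /= sqrf_eq0 subr_eq0 eqr_nat.
by move/eqP.
Qed.

(** The value m - 2 of s times the coincidence number is that of the
    juxtaposition of two saturated designs. *)
Lemma equidistant_gwlp2 (N m : nat) (D : 'M[S]_(N, m)) :
  (0 < N)%N -> (0 < #|S|)%N -> balanced D ->
  (m * (#|S| - 1) = 2 * (N - 1))%N ->
  (forall i j, i != j -> (#|S| * coin D i j + 2 = m)%N) ->
  gwlp c D 2 = N%:R - 1.
Proof.
move=> N_gt0 S_gt0 bD mE Dd.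
have s0 : s != 0 by rewrite pnatr_eq0 -lt0n.
have N0 : N%:R != 0 :> C by rewrite pnatr_eq0 -lt0n.
have mE' : m%:R * (s - 1) = 2 * (N%:R - 1) :> C.
  by have := congr1 (GRing.natmul (1 : C)) mE; rewrite !natrM !natrB.
rewrite gwlp2_coin // !mulr_sumr.
have -> : \sum_i s ^+ 2 * (\sum_j (coin D i j)%:R ^+ 2) =
   N%:R * ((N%:R - 1) * (m%:R - 2) ^+ 2 + (s * m%:R) ^+ 2).
  transitivity (\sum_(i < N) ((N%:R - 1) * (m%:R - 2) ^+ 2 + (s * m%:R) ^+ 2)).
    2: by rewrite sumr_const card_ord -[LHS]mulr_natl.
  apply: eq_bigr => i _.
  rewrite mulr_sumr (bigD1 i) //= coin_diag -exprMn addrC; congr (_ + _).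
  rewrite (eq_bigr (fun _ => (m%:R - 2) ^+ 2)) => [|j ne].
    rewrite sumr_const (cardC1 i) card_ord -subn1 -[LHS]mulr_natl.
    by rewrite natrB.
  rewrite eq_sym in ne; have := congr1 (GRing.natmul (1 : C)) (Dd i j ne).
  by rewrite natrD natrM -exprMn => /(canRL (addrK _)) ->.
have -> : s * m%:R = 2 * (N%:R - 1) + m%:R :> C by rewrite -mE'; ring.
by rewrite mE'; field.
Qed.

(** A saturated design with pairwise orthogonal columns is equidistant. *)
Lemma saturated_equidistant (N m : nat) (D : 'M[S]_(N, m)) :
  (0 < N)%N -> (0 < #|S|)%N -> balanced D ->
  (m * (#|S| - 1) = N - 1)%N ->
  (forall k l, k != l -> (col_coll D k l * #|S| ^ 2 = N ^ 2)%N) ->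
  forall i j, i != j -> (#|S| * coin D i j + 1 = m)%N.
Proof.
move=> N_gt0 S_gt0 bD mE oD i j nij.
have s0 : s != 0 by rewrite pnatr_eq0 -lt0n.
have N0 : N%:R != 0 :> C by rewrite pnatr_eq0 -lt0n.
have mE' : m%:R * (s - 1) = N%:R - 1 :> C.
  by have := congr1 (GRing.natmul (1 : C)) mE; rewrite !natrM !natrB.
pose v i j : C := s * (coin D i j)%:R - m%:R + 1.
have v_real k l : v k l \is Num.real.
  by rewrite rpredD ?rpredB ?rpredM ?realn ?rpred1.
(* Up to a scalar, v is the deviation of coin D from its expected value off the
   diagonal.  Its squares sum to N ^ 3 and the diagonal contributes all of it. *)
have v_diag k : v k k = N%:R.
  by rewrite /v coin_diag -[RHS](subrK 1) -mE'; ring.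
have sum_sq : \sum_k \sum_l (coin D k l)%:R ^+ 2
    = m%:R * (m%:R - 1) * N%:R ^+ 2 / s ^+ 2 + m%:R * N%:R ^+ 2 / s :> C.
  rewrite sum_coin_sq.
  rewrite (eq_bigr (fun _ => N%:R ^+ 2 / s + (m%:R - 1) * N%:R ^+ 2 / s ^+ 2)).
    by rewrite sumr_const card_ord -[LHS]mulr_natl; field.
  move=> k _; rewrite (bigD1 k) //= (col_coll_bal C S_gt0) //; congr (_ + _).
  rewrite (eq_bigr (fun _ => N%:R ^+ 2 / s ^+ 2)) => [|l nlk].
    rewrite sumr_const -[LHS]mulr_natl mulrA; congr (_ * _ / _).
    have m_gt0 : (0 < m)%N by apply: leq_ltn_trans (ltn_ord k).
    by rewrite (cardC1 k) card_ord -subn1 natrB.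
  apply: (canRL (mulfK _)); first by rewrite expf_neq0.
  by rewrite eq_sym in nlk; rewrite -!natrX -natrM oD.
have tot : \sum_k \sum_l v k l ^+ 2 = \sum_(k < N) N%:R ^+ 2.
  transitivity (s ^+ 2 * (\sum_k \sum_l (coin D k l)%:R ^+ 2)
     + 2 * s * (1 - m%:R) * (\sum_k \sum_l (coin D k l)%:R)
     + N%:R ^+ 2 * (1 - m%:R) ^+ 2 : C).
    have -> : N%:R ^+ 2 * (1 - m%:R) ^+ 2
       = \sum_(i < N) \sum_(j < N) (1 - m%:R) ^+ 2 :> C.
      by rewrite !sumr_const !card_ord -mulrnA -[RHS]mulr_natl natrM expr2.
    rewrite !mulr_sumr -!big_split; apply: eq_bigr => k _ /=.
    rewrite !mulr_sumr -!big_split; apply: eq_bigr => l _ /=.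
    by rewrite /v; ring.
  rewrite sum_sq (sum_coin_bal C S_gt0) // sumr_const card_ord -[RHS]mulr_natl.
  have N1 : N%:R = m%:R * (s - 1) + 1 :> C by rewrite mE' subrK.
  by transitivity (N%:R ^+ 2 * (m%:R * (s - 1) + 1)); [field | rewrite -N1; ring].
have off0 : \sum_k \sum_(l | l != k) v k l ^+ 2 = 0.
  apply: (addrI (\sum_k v k k ^+ 2)); rewrite addr0 -big_split /=.
  transitivity (\sum_k \sum_l v k l ^+ 2).
    by apply: eq_bigr => k _; rewrite [RHS](bigD1 k).
  by rewrite tot; apply: eq_bigr => k _; rewrite v_diag.
have v_ge0 k l : 0 <= v k l ^+ 2 by rewrite real_exprn_even_ge0.
have /eqP := off0; rewrite psumr_eq0 => [/allP/(_ i (mem_index_enum i))|k _].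
  rewrite /= psumr_eq0 // => /allP/(_ j (mem_index_enum j)).
  rewrite eq_sym nij /= sqrf_eq0 /v addrAC subr_eq0 -natrM natr1 eqr_nat.
  by rewrite addn1 => /eqP.
by apply: sumr_ge0.
Qed.

End Optimality.

(** * Aliasing of two columns and their collisions *)

Section Levels.

Variables (S : finType) (N m : nat) (D : 'M[S]_(N, m)) (k l : 'I_m).
Hypotheses (N_gt0 : (0 < N)%N) (S_gt0 : (0 < #|S|)%N) (bD : balanced D).

Lemma col_coll_levels :
  col_coll D k l = (\sum_xy level_count D k l xy ^ 2)%N.
Proof. by rewrite /col_coll coll_fibers. Qed.

Lemma sum_level_count : (\sum_xy level_count D k l xy = N)%N.
Proof.
rewrite -[RHS]card_ord -sum1_card (partition_big (fun i => (D i k, D i l)) xpredT) //=.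
by apply: eq_bigr => xy _; rewrite sum1dep_card.
Qed.

Lemma sum_level_count_mul t : (\sum_xy level_count D k l xy * t = N * t)%N.
Proof. by rewrite -big_distrl /= sum_level_count. Qed.

Lemma level_count_le xy : (level_count D k l xy * #|S| <= N)%N.
Proof.
rewrite -[leqRHS](bD k xy.1) leq_mul2r; apply/orP; right.
by apply/subset_leq_card/subsetP => i; rewrite !inE => /andP[].
Qed.

Lemma uniform_coll t : (0 < t)%N ->
  uniform_levels t D k l -> (col_coll D k l * t = N ^ 2)%N.
Proof.
move=> t_gt0 /andP[/eqP card_t /forall_inP lcP].
apply/eqP; rewrite -(eqn_pmul2r t_gt0); apply/eqP.
rewrite -mulnA mulnn col_coll_levels big_distrl /=.
rewrite (bigID (mem (level_combinations D k l))) /= [X in (_ + X)%N]big1 ?addn0.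
  under eq_bigr => xy /lcP/eqP e do rewrite -expnMn e.
  by rewrite sum_nat_const card_t mulnC.
by move=> xy; rewrite inE lt0n negbK => /eqP ->.
Qed.

(** No level combination occurs more than N / s times, and the sum of the squared
    counts is N ^ 2 / s only if every combination that occurs reaches this bound. *)
Lemma fully_aliasedE : fully_aliased D k l = (col_coll D k l * #|S| == N ^ 2)%N.
Proof.
apply/idP/eqP => [/uniform_coll-> // | coll_eq].
have lcE xy : (0 < level_count D k l xy -> level_count D k l xy * #|S| = N)%N.
  move=> lc_gt0; apply/eqP; rewrite eqn_leq level_count_le /= -subn_eq0.
  have : (\sum_xy level_count D k l xy * (N - level_count D k l xy * #|S|) = 0)%N.
    apply/eqP; rewrite -(eqn_add2l (N ^ 2)) addn0 -{1}coll_eq col_coll_levels.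
    rewrite big_distrl -big_split /= expnS expn1 -sum_level_count_mul.
    apply/eqP/eq_bigr => xy' _.
    by rewrite expnS expn1 -mulnA -mulnDr subnKC // level_count_le.
  move/eqP; rewrite sum_nat_eq0 => /forall_inP/(_ xy isT).
  by rewrite muln_eq0 => /orP[|//]; rewrite -leqn0 leqNgt lc_gt0.
apply/andP; split; last by apply/forall_inP => xy; rewrite inE => /lcE->.
rewrite -(eqn_pmul2r N_gt0) [X in _ == X]mulnC -sum_level_count_mul.
rewrite [X in _ == X](bigID (mem (level_combinations D k l))) /=.
rewrite [X in (_ == _ + X)%N]big1 ?addn0 => [|xy]; last first.
  by rewrite inE lt0n negbK => /eqP ->.
rewrite (eq_bigr (fun _ => N)) => [|xy]; last by rewrite inE => /lcE.
by rewrite sum_nat_const.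
Qed.

(** The sum of the squared counts of the level combinations is N ^ 2 / s ^ 2 only
    if their variance is zero. *)
Lemma orthogonal_columnsE :
  orthogonal_columns D k l = (col_coll D k l * #|S| ^ 2 == N ^ 2)%N.
Proof.
apply/idP/eqP => [/uniform_coll-> // | coll_eq]; first by rewrite expn_gt0 S_gt0.
have lcE xy : (level_count D k l xy * #|S| ^ 2 = N)%N.
  have : \sum_xy ((level_count D k l xy * #|S| ^ 2)%:R - N%:R : int) ^+ 2 = 0.
    transitivity (\sum_xy ((#|S| ^ 4)%:R * (level_count D k l xy ^ 2)%:R
      - (2 * N * #|S| ^ 2)%:R * (level_count D k l xy)%:R + (N ^ 2)%:R : int)).
      by apply: eq_bigr => xy' _; rewrite !(natrX, natrM); ring.
    rewrite big_split /= sumrB -!mulr_sumr -!natr_sum sum_level_count.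
    rewrite -col_coll_levels sumr_const card_prod -natrM mulnC.
    rewrite (_ : 4 = 2 + 2)%N // expnD mulnA coll_eq -[X in _ + X]mulr_natr.
    by rewrite !(natrX, natrM); ring.
  move/eqP; rewrite psumr_eq0 => [/allP/(_ xy (mem_index_enum _))/=|? _].
    by rewrite sqrf_eq0 subr_eq0 eqr_nat => /eqP.
  exact: sqr_ge0.
have lc_gt0 xy : (0 < level_count D k l xy)%N.
  by rewrite lt0n; apply: contraTneq N_gt0 => e; rewrite -(lcE xy) e.
apply/andP; split; last by apply/forall_inP => xy _; rewrite lcE.
rewrite (_ : level_combinations D k l = setT) ?cardsT ?card_prod ?mulnn //.
by apply/setP => xy; rewrite !inE lc_gt0.
Qed.

End Levels.

(** * Counting by translations *)

(* Makes F * F a finite additive group when F is a finite field. *)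
HB.saturate prod.

Section Shifts.

(** If maps tau t of U into itself, indexed by t : F, raise the value of phi
    by t, then all the level sets of phi in U have the same size. *)
Lemma card_level (F : finZmodType) (T : finType) (U : {set T})
    (tau : F -> T -> T) (phi : T -> F) :
  (forall t, injective (tau t)) ->
  (forall t x, x \in U -> tau t x \in U) ->
  (forall t x, x \in U -> phi (tau t x) = phi x + t) ->
  forall v, (#|[set x in U | phi x == v]| * #|F| = #|U|)%N.
Proof.
move=> tauI tauU phi_tau v.
have le u w : (#|[set x in U | phi x == u]| <= #|[set x in U | phi x == w]|)%N.
  rewrite -(card_imset _ (tauI (w - u))); apply/subset_leq_card/subsetP => y.
  case/imsetP => x; rewrite inE => /andP[xU /eqP xu] ->.
  by rewrite inE tauU // phi_tau // xu addrC subrK eqxx.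
rewrite -[RHS]sum1_card (partition_big phi xpredT) //=.
rewrite (eq_bigr (fun _ => #|[set x in U | phi x == v]|)) => [|w _].
  by rewrite sum_nat_const mulnC.
by rewrite sum1dep_card; apply/eqP; rewrite eqn_leq !le.
Qed.

Variables (F : finZmodType) (T : finType).

Lemma coll_eq (U1 U2 : eqType) (f : T -> U1) (g : T -> U2) :
  (forall x y, (f x == f y) = (g x == g y)) -> coll f = coll g.
Proof. by move=> e; apply: eq_card => p; rewrite !inE e. Qed.

(** If moving along tau preserves f and shifts g, then reading g in addition to f
    divides the number of collisions by #|F|. *)
Lemma coll_shift (U : eqType) (f : T -> U) (g : T -> F) (tau : F -> T -> T) :
  (forall t, injective (tau t)) ->
  (forall t x, f (tau t x) = f x) ->
  (forall t x, g (tau t x) = g x + t) ->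
  (coll (fun x => (f x, g x)) * #|F| = coll f)%N.
Proof.
move=> tauI fE gE.
rewrite [RHS]/coll -(card_level (U := [set p : T * T | f p.1 == f p.2])
  (tau := fun t p => (tau t p.1, p.2)) (phi := fun p => g p.1 - g p.2) _ _ _ 0).
- by congr (_ * _)%N; apply: eq_card => p; rewrite !inE xpair_eqE subr_eq0.
- by move=> t [x y] [x' y'] [/tauI-> ->].
- by move=> t [x y]; rewrite !inE /= fE.
by move=> t [x y] _; rewrite /= gE addrAC.
Qed.

Lemma coll_balanced (g : T -> F) (tau : F -> T -> T) :
  (forall t, injective (tau t)) ->
  (forall t x, g (tau t x) = g x + t) ->
  (coll g * #|F| = #|T| ^ 2)%N.
Proof.
move=> tauI gE; have := coll_shift (f := fun=> tt) tauI (fun _ _ => erefl) gE.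
rewrite (coll_eq (g := g)) => [->|x y]; last by rewrite xpair_eqE.
rewrite /coll (eq_card (B := predT)) ?card_prod ?mulnn //.
by move=> p; rewrite !inE eqxx.
Qed.

(** Collisions of a function that factors through a map with fibers of equal
    size. *)
Lemma coll_factor (T' U : finType) (pi : T -> T') (f : T' -> U) :
  (forall y, #|[set x | pi x == y]| * #|T'| = #|T|)%N ->
  (coll (f \o pi) * #|T'| ^ 2 = #|T| ^ 2 * coll f)%N.
Proof.
move=> piP; rewrite !coll_fibers big_distrl big_distrr /=; apply: eq_bigr => v _.
rewrite -!expnMn; congr (_ ^ 2)%N.
transitivity (\sum_(y | f y == v) #|[set x | pi x == y]| * #|T'|)%N.
  rewrite -big_distrl /=; congr (_ * _)%N.
  rewrite -sum1dep_card (partition_big pi (fun y => f y == v)) //=.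
  apply: eq_bigr => y yv; rewrite -sum1dep_card; apply: eq_bigl => x.
  by rewrite andb_idl // => /eqP->.
rewrite (eq_bigr (fun _ => #|T|)) // sum_nat_const mulnC; congr (_ * _)%N.
by apply: eq_card => y; rewrite !inE.
Qed.

End Shifts.

(** The collisions of f, sorted by the difference w of the two points. *)
Lemma coll_diff (T : finZmodType) (U : eqType) (f : T -> U) :
  coll f = (\sum_w #|[set x | f (x + w)%R == f x]|)%N.
Proof.
under [RHS]eq_bigr => w _ do rewrite -sum1dep_card.
rewrite /coll -sum1dep_card -(pair_big_dep xpredT (fun x y => f x == f y) (fun _ _ => 1%N)) /=.
rewrite [RHS](exchange_big_dep xpredT) //=; apply: eq_bigr => x _.
rewrite (reindex_inj (addrI x)) /=; apply: eq_bigl => w.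
exact: eq_sym.
Qed.

Lemma coll_additive (T U : finZmodType) (f : T -> U) :
  {morph f : x y / x + y} ->
  (coll f = #|T| * #|[set x | f x == 0%R]|)%N.
Proof.
move=> fD; rewrite coll_diff.
rewrite (eq_bigr (fun w => if f w == 0 then #|T| else 0%N)) => [|w _].
  by rewrite -big_mkcond sum_nat_const mulnC cardsE.
case: eqP => fw.
  by rewrite -cardsT; apply: eq_card => x; rewrite !inE fD fw addr0 eqxx.
by apply: eq_card0 => x; rewrite !inE fD -subr_eq0 addrC addKr; apply/eqP.
Qed.

Lemma even_card_involution (T : finType) (A : {set T}) (f : T -> T) :
  involutive f -> (forall x, x \in A -> f x \in A) -> (forall x, f x != x) ->
  ~~ odd #|A|.
Proof.
move=> fK fA fN; have [n] := ubnP #|A|; elim: n A fA => // n IHn A fA.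
have [->|[x xA]] := set_0Vmem A; first by rewrite cards0.
rewrite ltnS (cardsD1 x) xA (cardsD1 (f x)) !inE fN fA //= !addnA => le.
rewrite add0n negbK; apply: IHn => [y|]; last by apply: ltnW.
rewrite !inE => /and3P[yfx yx yA]; rewrite fA // andbT.
by rewrite (inj_eq (inv_inj fK)) yx (contraNneq _ yfx) // => <-; rewrite fK.
Qed.

(** * Collisions of quadratic maps on the plane *)

Section PlaneCounts.

Variable F : finFieldType.
Local Notation s := #|F|.

(** In the coordinates z = (h1, h2), with the linear parts absorbed in the
    parameters, [plane1] has the collisions of the columns h1 and
    h2 ^ 2 + a2 h2 + g2 where g2 vanishes on the common kernel Z of h1 and h2;
    [plane2] describes the columns h1 ^ 2 + a1 h1 + g1 and h2 ^ 2 + a2 h2 + g2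
    where both g1 and g2 vanish on Z; [plane3] is the combination f2 - c f1 of
    two such columns f1, f2 with g2 equal to c g1 on Z. *)
Definition plane1 (b : F) (z : F * F) : F * F := (z.1, z.2 ^+ 2 + b * z.2).
Definition plane2 (a b la mu : F) (z : F * F) : F * F :=
  (z.1 ^+ 2 + a * z.1 + mu * z.2, z.2 ^+ 2 + b * z.2 + la * z.1).
Definition plane3 (c a b : F) (z : F * F) : F :=
  z.2 ^+ 2 + b * z.2 - c * z.1 ^+ 2 - a * z.1.

Lemma card_plane_line (a b r : F) : (a, b) != (0, 0) ->
  #|[set z : F * F | a * z.1 + b * z.2 == r]| = s.
Proof.
move=> nz; have F_gt0 : (0 < s)%N by apply/card_gt0P; exists 0.
have [p pP] : exists p : F * F, a * p.1 + b * p.2 = 1.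
  have [a0|a0] := eqVneq a 0; last by exists (a^-1, 0); rewrite /= mulfV // mulr0 addr0.
  exists (0, b^-1); rewrite /= mulr0 add0r mulfV //.
  by apply: contraNneq nz => ->; rewrite a0.
apply/eqP; rewrite -(eqn_pmul2r F_gt0); apply/eqP.
have := @card_level F _ setT (fun t z => (z.1 + t * p.1, z.2 + t * p.2))
   (fun z : F * F => a * z.1 + b * z.2) _ _ _ r.
rewrite cardsT card_prod => <-.
- by congr (_ * _)%N; apply: eq_card => z; rewrite !inE.
- by move=> t [x y] [x' y'] [/addIr-> /addIr->].
- by move=> t z; rewrite !inE.
by move=> t z _ /=; rewrite -[in RHS](mulr1 t) -pP; ring.
Qed.

(** In odd characteristic f (x + w) - f x is an affine function of x for every
    fixed w = (d, e), so that the solutions of f (x + w) = f x are counted by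
    linear algebra. *)
Section Odd.

Hypothesis two0 : 2 != 0 :> F.

Lemma coll_plane1_odd b : (coll (plane1 b) = s * (2 * s - 1))%N.
Proof.
have F_gt0 : (0 < s)%N by apply/card_gt0P; exists 0.
rewrite coll_diff -(pair_bigA _ (fun d e =>
  #|[set x | plane1 b (x + (d, e)) == plane1 b x]|)) /=.
rewrite (bigD1 0) //= [X in (_ + X)%N]big1 ?addn0 => [|d d0]; last first.
  rewrite big1 // => e _; apply: eq_card0 => x; rewrite !inE xpair_eqE /=.
  by rewrite -subr_eq0 addrC addKr (negbTE d0).
rewrite (bigD1 0) //= (eq_bigr (fun _ => s)) => [|e e0].
  rewrite sum_nat_const cardC1 (_ : #|_| = s * s)%N; first by case: #|F| F_gt0 => // p _; nia.
  rewrite -card_prod -cardsT; apply: eq_card => x; rewrite !inE.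
  by rewrite (_ : x + _ = x) ?eqxx //; apply/eqP; rewrite -subr_eq0 addrC addKr.
rewrite -(@card_plane_line 0 (2 * e) (- (e ^+ 2 + b * e))); last first.
  by rewrite xpair_eqE negb_and mulf_neq0 ?orbT.
apply: eq_card => x; rewrite !inE xpair_eqE /= addr0 eqxx /=.
rewrite -subr_eq0 -[RHS]subr_eq0; congr (_ == _); ring.
Qed.

Lemma coll_plane3_odd c a b : c != 0 ->
  (coll (plane3 c a b) = s ^ 2 + (s ^ 2 - 1) * s)%N.
Proof.
move=> c0; rewrite coll_diff (bigD1 0) //= (eq_bigr (fun _ => s)) => [|[d e] de0].
  rewrite sum_nat_const cardC1 card_prod subn1 (_ : #|_| = s * s)%N //.
  by rewrite -card_prod -cardsT; apply: eq_card => x; rewrite !inE addr0 eqxx.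
rewrite -(@card_plane_line (- (c * (2 * d))) (2 * e)
  (c * d ^+ 2 + a * d - e ^+ 2 - b * e)); last first.
  apply: contraNneq de0 => -[/eqP]; rewrite oppr_eq0 !mulf_eq0 (negbTE c0).
  by rewrite (negbTE two0) /= => /eqP-> /eqP; rewrite mulf_eq0 (negbTE two0) => /eqP->.
apply: eq_card => x; rewrite !inE /plane3 /=.
rewrite -subr_eq0 -[RHS]subr_eq0; congr (_ == _); ring.
Qed.

Lemma coll_plane2_odd a b la mu : la != 0 -> mu != 0 ->
  (coll (plane2 a b la mu) = s ^ 2 + (s - 1) ^ 2)%N.
Proof.
move=> la0 mu0.
rewrite coll_diff -(pair_bigA _ (fun d e =>
  #|[set x | plane2 a b la mu (x + (d, e)) == plane2 a b la mu x]|)) /=.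
have cnt d e : #|[set x | plane2 a b la mu (x + (d, e)) == plane2 a b la mu x]| =
   if d == 0 then if e == 0 then (s ^ 2)%N else 0%N
   else if e == 0 then 0%N else 1%N.
  have -> : [set x | plane2 a b la mu (x + (d, e)) == plane2 a b la mu x] =
    [set x : F * F | (2 * d * x.1 + (d ^+ 2 + a * d + mu * e) == 0) &&
               (2 * e * x.2 + (e ^+ 2 + b * e + la * d) == 0)].
    apply/setP => x; rewrite !inE xpair_eqE /=.
    by congr (_ && _); rewrite -subr_eq0; congr (_ == _); ring.
  case: (eqVneq d 0) => [->|d0]; case: (eqVneq e 0) => [->|e0].
  - rewrite -mulnn -card_prod -cardsT; apply: eq_card => x; rewrite !inE.
    by rewrite !(mulr0, mul0r, addr0, expr0n) /= eqxx.
  - apply: eq_card0 => x; rewrite !inE !(mulr0, mul0r, addr0, add0r, expr0n) /=.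
    by rewrite mulf_eq0 (negbTE mu0) (negbTE e0).
  - apply: eq_card0 => x; rewrite !inE !(mulr0, mul0r, addr0, add0r, expr0n) /=.
    by rewrite mulf_eq0 (negbTE la0) (negbTE d0) andbF.
  rewrite -[RHS](cards1 (- (d ^+ 2 + a * d + mu * e) / (2 * d),
     - (e ^+ 2 + b * e + la * d) / (2 * e))).
  apply: eq_card => -[x y]; rewrite !inE xpair_eqE /=.
  have lin (A z B : F) : A != 0 -> (A * z + B == 0) = (z == - B / A) :> bool.
    by move=> A0; rewrite addr_eq0; apply/eqP/eqP => [<-|->]; field.
  by rewrite !lin ?mulf_neq0.
under eq_bigr => d _ do under eq_bigr => e _ do rewrite cnt.
rewrite (bigD1 0) //= eqxx (bigD1 0) //= [X in (_ + X + _)%N]big1 => [|e /negbTE->//].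
rewrite addn0; congr (_ + _)%N; first by rewrite eqxx.
rewrite (eq_bigr (fun _ => (s - 1)%N)) => [|d /negbTE->].
  by rewrite sum_nat_const cardC1 -subn1 mulnn.
rewrite (bigD1 0) //= eqxx add0n (eq_bigr (fun _ => 1%N)) => [|e /negbTE->//].
by rewrite sum_nat_const cardC1 muln1 subn1.
Qed.

End Odd.

End PlaneCounts.

(** * Collisions of quadratic maps in characteristic two *)

Section Even.

Variable F : finFieldType.
Local Notation s := #|F|.


Hypothesis char2 : 2 = 0 :> F.

Let addxx (x : F) : x + x = 0.
Proof. by rewrite -mulr2n -mulr_natl char2 mul0r. Qed.

Let oppx (x : F) : - x = x.
Proof. by apply/eqP; rewrite -subr_eq0 -opprD addxx oppr0. Qed.

Let sqrD (x y : F) : (x + y) ^+ 2 = x ^+ 2 + y ^+ 2.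
Proof. by rewrite sqrrD -mulr_natl char2 mul0r addr0. Qed.

Let eq_mod2 (x y z : F) : x = y + 2 * z -> x = y.
Proof. by rewrite char2 mul0r addr0. Qed.

Lemma char2_card_even : ~~ odd s.
Proof.
rewrite -cardsT; apply: (@even_card_involution _ _ (fun x : F => x + 1)) => [x|x|x].
- by rewrite -addrA addxx addr0.
- by rewrite !inE.
by rewrite -subr_eq0 addrC addKr oner_eq0.
Qed.

Lemma sqrt_char2 (c : F) : exists g : F, g ^+ 2 = c.
Proof.
exists (c ^+ s./2); rewrite -exprM muln2 -[RHS]expf_card; congr (_ ^+ _).
by rewrite -[RHS]odd_double_half (negbTE char2_card_even).
Qed.

Lemma coll_plane1_even (b : F) :
  (coll (plane1 b) = s ^ 2 * (1 + (b != 0%R)))%N.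
Proof.
rewrite coll_additive => [|[x y] [x' y']]; last first.
  by congr (_, _); rewrite /= sqrD mulrDr addrACA.
rewrite card_prod mulnn; congr (_ * _)%N.
transitivity #|[set (0 : F, 0 : F); (0, b)]|; last first.
  by rewrite cards2 xpair_eqE eqxx /= eq_sym.
apply: eq_card => -[x y]; rewrite !inE !xpair_eqE -andb_orr /=.
by rewrite expr2 -mulrDl mulf_eq0 addr_eq0 oppx orbC.
Qed.

(** The shear y + g x with g ^ 2 = c turns the quadratic part into a square, so
    that the kernel becomes y ^ 2 + b y + (b g + a) x = 0, which is a graph over
    y, or a product with {0, b} when b g + a = 0. *)
Lemma coll_plane3_even (c a b : F) : c != 0 ->
  exists2 j, (coll (plane3 c a b) = s ^ 3 * j)%N & (0 < j <= 2)%N.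
Proof.
move=> c0; have [g gE] := sqrt_char2 c.
rewrite coll_additive => [|[x y] [x' y']]; last first.
  by rewrite /plane3 /= !sqrD; ring.
rewrite card_prod.
pose k := b * g + a.
have shI : injective (fun z : F * F => (z.1, z.2 + g * z.1)).
  by move=> [x y] [x' y'] [-> /addIr->].
have -> : #|[set x | plane3 c a b x == 0]|
    = #|[set z : F * F | z.2 ^+ 2 + b * z.2 + k * z.1 == 0]|.
  rewrite -(card_imset _ shI); apply: eq_card => -[x y]; rewrite !inE /=.
  apply/imsetP/idP => [[[x' y']]|/eqP e].
    rewrite inE /plane3 /= => /eqP e [-> ->]; rewrite -[X in _ == X]e; apply/eqP.
    by rewrite /k -gE; apply: (@eq_mod2 _ _ (g*x'*y' + g^+2 * x'^+2 + b*g*x' + a*x')); ring.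
  exists (x, y + g * x); last by congr (_, _); rewrite /= -addrA addxx addr0.
  rewrite inE /plane3 /= -[X in _ == X]e; apply/eqP.
  by rewrite /k -gE; apply: (@eq_mod2 _ _ (g * x * y - a * x)); ring.
have [->|k0] := eqVneq k 0.
  exists (1 + (b != 0%R))%N; last by case: (b != 0).
  transitivity (s * s * (s * (1 + (b != 0%R))))%N; last by rewrite !expnS expn0; lia.
  congr (_ * _)%N; transitivity #|setX [set: F] [set 0; b]|.
    apply: eq_card => -[x y]; rewrite !inE /= mul0r addr0.
    by rewrite expr2 -mulrDl mulf_eq0 addr_eq0 oppx orbC.
  by rewrite cardsX cardsT cards2 eq_sym.
exists 1%N => //; rewrite muln1 !expnS expn0 muln1 -mulnA; congr (_ * (_ * _))%N.
rewrite -cardsT -(card_imset _ (_ : injective (fun y => (- (y ^+ 2 + b * y) / k, y)))).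
  apply: eq_card => -[x y]; rewrite !inE /=; apply/eqP/imsetP => [e|[y' _ [-> ->]]].
    exists y => //; congr (_, _); apply: (mulIf k0); rewrite mulfVK //.
    by apply/eqP; rewrite -addr_eq0 mulrC addrC e.
  by rewrite mulrCA mulfV // mulr1 subrr.
by move=> y y' [].
Qed.

(** The kernel of [plane2] projects injectively to its first coordinate; the image
    is the zero set of the additive quartic obtained by eliminating the second. *)
Definition quartic_roots (a b la mu : F) : {set F} :=
  [set t | (t ^+ 2 + a * t) ^+ 2 + b * mu * (t ^+ 2 + a * t) + la * mu ^+ 2 * t == 0].

Lemma coll_plane2_roots (a b la mu : F) : mu != 0 ->
  (coll (plane2 a b la mu) = s ^ 2 * #|quartic_roots a b la mu|)%N.
Proof.
move=> mu0; rewrite coll_additive => [|[x y] [x' y']]; last first.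
  by congr (_, _); rewrite /= sqrD; ring.
rewrite card_prod mulnn; congr (_ * _)%N.
rewrite -[RHS](card_imset _ (_ : injective (fun t => (t, (t ^+ 2 + a * t) / mu)))).
  2: by move=> t t' [].
apply: eq_card => -[x y]; rewrite !inE /plane2 xpair_eqE /=.
apply/andP/imsetP => [[/eqP e1 /eqP e2]|[t]].
  have yE : y = (x ^+ 2 + a * x) / mu.
    apply: (mulIf mu0); rewrite mulfVK //; apply/eqP.
    by rewrite -[X in _ == X]oppx -addr_eq0 addrC [y * _]mulrC e1.
  exists x; last by rewrite -yE.
  rewrite inE; apply/eqP; rewrite -[RHS](mulr0 (mu ^+ 2)) -e2 yE.
  by field.
rewrite inE => /eqP e [-> ->]; rewrite mulrCA mulfV // mulr1 addxx eqxx.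
split=> //; apply/eqP/(mulfI (expf_neq0 2 mu0)); rewrite mulr0 -[RHS]e.
by field.
Qed.

(** A quartic has at most 4 roots; 3 is excluded because translation by a nonzero
    root is a fixed point free involution of the roots. *)
Lemma card_quartic_roots a b la mu :
  #|quartic_roots a b la mu| \in [:: 1; 2; 4]%N.
Proof.
set R := quartic_roots a b la mu.
have R0 : 0 \in R by rewrite inE !(mulr0, expr0n, addr0).
have R4 : (#|R| <= 4)%N.
  pose p : {poly F} := 'X^4 + (((a ^+ 2 + b * mu) *: 'X^2)
    + (a * b * mu + la * mu ^+ 2) *: 'X).
  have sz : size p = 5%N.
    rewrite size_polyDl size_polyXn // (leq_ltn_trans (size_polyD _ _)) //.
    rewrite gtn_max !(leq_ltn_trans (size_scale_leq _ _)) ?size_polyXn ?size_polyX //.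
  rewrite cardE -ltnS -sz max_poly_roots ?enum_uniq //.
    by rewrite -size_poly_eq0 sz.
  apply/allP => t; rewrite mem_enum inE => /eqP e.
  rewrite rootE /p !(hornerD, hornerZ, hornerXn, hornerX).
  by rewrite -[X in _ == X]e; apply/eqP/(@eq_mod2 _ _ (- (a * t ^+ 3))); ring.
have [odd1|] : (#|R| = 1)%N \/ ~~ odd #|R|.
- have [Re|[t]] := set_0Vmem (R :\ 0); first by left; rewrite (cardsD1 0) R0 Re cards0.
  rewrite !inE => /andP[t0 /eqP tR]; right.
  apply: (@even_card_involution _ _ (fun x => x + t)) => [x|x|x].
  + by rewrite -addrA addxx addr0.
  + rewrite !inE => /eqP xR; apply/eqP.
    rewrite -[RHS](addr0 0) -[X in _ = X + _]xR -[X in _ = _ + X]tR.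
    pose A := x ^+ 2 + a * x; pose B := t ^+ 2 + a * t.
    apply: (@eq_mod2 _ _ (A * B + 2 * x * t * (A + B) + 2 * x ^+ 2 * t ^+ 2
      + b * mu * x * t)).
    by rewrite /A /B; ring.
  by rewrite -subr_eq0 addrC addKr.
- by rewrite odd1.
have : (0 < #|R|)%N by apply/card_gt0P; exists 0.
by move: #|R| R4 => [|[|[|[|[|]]]]].
Qed.

(** Over the field with four elements the quartic has degree at most 2 as a
    function, so it has four roots only if its reduced coefficients vanish. *)
Lemma card_quartic_roots4 a b mu : s = 4%N -> mu != 0 ->
  (#|quartic_roots a b mu mu| == 4%N) = (a == 0) && (b == 0).
Proof.
move=> s4 mu0; have pow4 (x : F) : x ^+ 4 = x by rewrite -s4 expf_card.
have mu3 : mu ^+ 3 = 1 by apply: (mulfI mu0); rewrite -exprS pow4 mulr1.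
have rootE t : (t \in quartic_roots a b mu mu)
    = ((a ^+ 2 + b * mu) * t ^+ 2 + a * b * mu * t == 0).
  rewrite inE; congr (_ == _).
  apply: (@eq_mod2 _ _ (a * t ^+ 3 + t)).
  transitivity ((a ^+ 2 + b * mu) * t ^+ 2 + a * b * mu * t
     + (t ^+ 4 + mu ^+ 3 * t + 2 * (a * t ^+ 3))); first by ring.
  by rewrite pow4 mu3; ring.
apply/eqP/andP => [c4|[/eqP a0 /eqP b0]]; last first.
  rewrite -s4 -cardsT; apply: eq_card => t; rewrite rootE a0 b0 !inE.
  by rewrite !(expr0n, mul0r, addr0) eqxx.
have allR t : (a ^+ 2 + b * mu) * t ^+ 2 + a * b * mu * t = 0.
  apply/eqP; rewrite -rootE (_ : quartic_roots _ _ _ _ = setT) ?inE //.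
  by apply/eqP; rewrite eqEcard subsetT cardsT s4 c4.
have [w [w1 w0]] : exists w : F, w != 1 /\ w != 0.
  pose E : {set F} := [set 0; 1]; have : (0 < #|~: E|)%N.
    by rewrite -(ltn_add2l #|E|) cardsC addn0 s4 cards2; case: (_ != _).
  by case/card_gt0P => w; rewrite !inE negb_or => /andP[w0 w1]; exists w.
have e1 := allR 1; have ew := allR w.
rewrite expr1n !mulr1 in e1.
have A0 : a ^+ 2 + b * mu = 0.
  have : (a ^+ 2 + b * mu) * (w * (w - 1)) = 0.
    by rewrite -[RHS](subr0 0) -{1}ew -(mulr0 w) -e1; ring.
  by move/eqP; rewrite !mulf_eq0 (negbTE w0) subr_eq0 (negbTE w1) !orbF => /eqP.
rewrite A0 add0r in e1.
have a0 : a = 0.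
  have : a ^+ 3 = 0.
    by rewrite -[RHS](mulr0 a) -A0 -[LHS]addr0 -e1; ring.
  by move/eqP; rewrite expf_eq0 => /andP[_ /eqP].
split; first by rewrite a0.
by move: A0; rewrite a0 expr0n add0r => /eqP; rewrite mulf_eq0 (negbTE mu0) orbF.
Qed.

End Even.

(** * Linear forms and the columns of Q_h *)

Lemma last_nonzeroP (F : finFieldType) (n : nat) (h : 'rV[F]_n) (k : 'I_n) :
  reflect (h 0 k != 0 /\ forall j : 'I_n, (k < j)%N -> h 0 j = 0) (last_nonzero h k).
Proof.
apply: (iffP andP) => [[h0 /forallP hj]|[h0 hj]]; split=> //.
  by move=> j kj; have /implyP/(_ kj)/eqP := hj j.
by apply/forallP => j; apply/implyP => /hj->.
Qed.

Section Forms.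

Variables (F : finFieldType) (n : nat).
Local Notation s := #|F|.
Local Notation V := 'rV[F]_n.
Implicit Types (h g x y w : V) (k : 'I_n) (a b t : F).

Lemma lin_formD h x y : lin_form h (x + y) = lin_form h x + lin_form h y.
Proof. by rewrite -big_split; apply: eq_bigr => i _; rewrite mxE mulrDr. Qed.

Lemma lin_formZ h t x : lin_form h (t *: x) = t * lin_form h x.
Proof. by rewrite mulr_sumr; apply: eq_bigr => i _; rewrite mxE mulrCA. Qed.

Lemma lin_formDl h g x : lin_form (h + g) x = lin_form h x + lin_form g x.
Proof. by rewrite -big_split; apply: eq_bigr => i _; rewrite mxE mulrDl. Qed.

Lemma lin_formZl t h x : lin_form (t *: h) x = t * lin_form h x.
Proof. by rewrite mulr_sumr; apply: eq_bigr => i _; rewrite mxE mulrA. Qed.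

Lemma lin_form_delta h k : lin_form h (delta_mx 0 k) = h 0 k.
Proof.
rewrite /lin_form (bigD1 k) //= big1 => [|i ik].
  by rewrite mxE !eqxx mulr1 addr0.
by rewrite mxE eqxx (negbTE ik) mulr0.
Qed.

Lemma lin_form_inj h g : (forall x, lin_form h x = lin_form g x) -> h = g.
Proof. by move=> e; apply/rowP => i; rewrite -!lin_form_delta. Qed.

(** The form h belongs to H(X_1, ..., X_n): its last nonzero coefficient, at the
    index k, is 1. *)
Definition monic_at h k := last_nonzero h k && (h 0 k == 1).
Definition monic h := [exists k, monic_at h k].

Lemma last_nonzero_uniq h k l : last_nonzero h k -> last_nonzero h l -> k = l.
Proof.
move=> /last_nonzeroP[hk ck] /last_nonzeroP[hl cl].
case: (ltngtP k l) => [/ck e|/cl e|/val_inj//]; first by rewrite e eqxx in hl.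
by rewrite e eqxx in hk.
Qed.

Lemma last_nonzeroZ t h k : t != 0 -> last_nonzero (t *: h) k = last_nonzero h k.
Proof.
move=> t0; rewrite /last_nonzero mxE mulf_eq0 (negbTE t0); congr (_ && _).
by apply: eq_forallb => j; rewrite mxE mulf_eq0 (negbTE t0).
Qed.

Lemma last_nonzero_exists h : h != 0 -> exists k, last_nonzero h k.
Proof.
move=> h0; have [i hi] : exists i, h 0 i != 0.
  apply/existsP; apply: contraR h0 => /existsPn hi.
  by apply/eqP/rowP => i; have /negPn/eqP-> := hi i; rewrite mxE.
exists [arg max_(k > i | h 0 k != 0) k]; case: arg_maxnP => // k hk kmax.
apply/last_nonzeroP; split=> // j; apply: contraTeq => hj.
by rewrite -leqNgt; apply: kmax.
Qed.

Lemma monic_neq0 h : monic h -> h != 0.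
Proof.
case/existsP => k /andP[/last_nonzeroP[hk _] _].
by apply: contraNneq hk => ->; rewrite mxE.
Qed.

Lemma monic_scale h g t u :
  t != 0 -> monic h -> monic g -> t *: h = u *: g -> t = u /\ h = g.
Proof.
move=> t0 /existsP[k /andP[hk /eqP hk1]] /existsP[l /andP[gl /eqP gl1]] e.
have u0 : u != 0.
  apply: contraNneq t0 => u0; move/rowP/(_ k): e.
  by rewrite u0 scale0r !mxE hk1 mulr1 => ->.
have kl : k = l.
  apply: (@last_nonzero_uniq (t *: h)); first by rewrite last_nonzeroZ.
  by rewrite e last_nonzeroZ.
subst l; have tu : t = u.
  by move/rowP/(_ k): e; rewrite !mxE hk1 gl1 !mulr1.
by split=> //; apply: (scalerI t0); rewrite e tu.
Qed.

Lemma monic_multiple h : h != 0 -> exists2 t, t != 0 & monic (t *: h).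
Proof.
move=> h0; have [k hk] := last_nonzero_exists h0.
have /last_nonzeroP[hk0 _] := hk.
exists (h 0 k)^-1; first by rewrite invr_eq0.
apply/existsP; exists k; rewrite /monic_at last_nonzeroZ ?invr_eq0 // hk.
by rewrite mxE mulVf ?eqxx.
Qed.

(** Every nonzero form has exactly one monic multiple. *)
Lemma card_monic (P : {set V}) :
  0 \notin P -> (forall t h, t != 0 -> h \in P -> t *: h \in P) ->
  (#|[set h in P | monic h]| * (s - 1) = #|P|)%N.
Proof.
move=> P0 PZ; pose f (p : V * F) := p.2 *: p.1.
have <- : #|[set t : F | t != 0]| = (s - 1)%N.
  by rewrite subn1 -(cardC1 (0 : F)); apply: eq_card => t; rewrite !inE.
rewrite -cardsX -(card_in_imset (f := f)).
  apply: eq_card => g; apply/imsetP/idP => [[[h t]]|gP].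
    by rewrite !inE /= => /andP[/andP[hP _] t0] ->; apply: PZ.
  have g0 : g != 0 by apply: contraNneq P0 => <-.
  have [t t0 tg] := monic_multiple g0.
  exists (t *: g, t^-1); first by rewrite !inE /= tg PZ // invr_eq0 t0.
  by rewrite /f /= scalerA mulVf // scale1r.
move=> [h t] [h' t']; rewrite !inE /= => /andP[/andP[_ mh] t0] /andP[/andP[_ mh'] _].
by move=> /(monic_scale t0 mh mh')[-> ->].
Qed.

Lemma H_forms1 h : (h \in H_forms (1%:M : 'M[F]_n)) = monic h.
Proof.
apply/imsetP/idP => [[d]|mh]; first by rewrite inE mulmx1 => ? ->.
by exists h; rewrite ?mulmx1 // inE.
Qed.

(** Leaving X_k out of the variables amounts to requiring a zero coefficient at k,
    since the order of the other variables is kept. *)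
Lemma H_forms_row' k g :
  (g \in H_forms (row' k (1%:M : 'M[F]_n))) = monic g && (g 0 k == 0).
Proof.
have row'E (d : 'rV[F]_n.-1) : (d *m row' k (1%:M : 'M[F]_n)) 0 k = 0 /\
    forall i, (d *m row' k (1%:M : 'M[F]_n)) 0 (lift k i) = d 0 i.
  split=> [|i].
    by rewrite mxE big1 // => j _; rewrite !mxE eq_sym (negbTE (neq_lift _ _)) mulr0.
  rewrite mxE (bigD1 i) //= !mxE eqxx mulr1 big1 ?addr0 // => j ji.
  by rewrite !mxE (inj_eq lift_inj) (negbTE ji) mulr0.
have monicE (d : 'rV[F]_n.-1) g' : g' 0 k = 0 -> (forall i, g' 0 (lift k i) = d 0 i) ->
   monic g' = [exists l, last_nonzero d l && (d 0 l == 1)].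
  move=> g'k g'E; apply/existsP/existsP => -[l /andP[/last_nonzeroP[l0 lj] l1]].
    case: (unliftP k l) l0 lj l1 => [i ->|->]; last by rewrite g'k eqxx.
    move=> l0 lj l1; exists i; rewrite -g'E l1 andbT; apply/last_nonzeroP.
    split=> [|j ij]; rewrite -g'E // lj //=.
    by rewrite ltnNge leq_bump2 -ltnNge.
  exists (lift k l); rewrite /monic_at g'E l1 andbT; apply/last_nonzeroP.
  split=> [|j]; rewrite ?g'E //; case: (unliftP k j) => [i ->|-> //].
  by rewrite g'E ltnNge leq_bump2 -ltnNge; apply: lj.
apply/imsetP/andP => [[d]|[mg /eqP gk]].
  have [e1 e2] := row'E d.
  by rewrite inE => md ->; rewrite e1 eqxx (monicE d) .
pose d : 'rV[F]_n.-1 := \row_i g 0 (lift k i).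
exists d; first by rewrite inE -(monicE d g) // => i; rewrite mxE.
have [e1 e2] := row'E d; apply/rowP => j.
by case: (unliftP k j) => [i ->|->]; rewrite ?e1 // e2 mxE.
Qed.

(** The columns of Q_h: the form h itself, and h ^ 2 + a h + g. *)
Definition linf h : {ffun V -> F} := [ffun x => lin_form h x].
Definition quad h a g : {ffun V -> F} :=
  [ffun x => lin_form h x ^+ 2 + a * lin_form h x + lin_form g x].

Lemma Q_ofP h k f : monic_at h k ->
  reflect (f = linf h \/
           exists a g, [/\ monic g, g 0 k = 0 & f = quad h a g])
          (f \in Q_of h).
Proof.
move=> /andP[hk _]; rewrite /Q_of; case: pickP => [l hl|/(_ k)]; last by rewrite hk.
rewrite (last_nonzero_uniq hl hk) in_setU1.
apply: (iffP orP) => -[/eqP->|]; [by left| | by left|].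
  case/imset2P => a g _; rewrite H_forms_row' => /andP[mg /eqP gk] ->.
  by right; exists a, g.
case=> a [g [mg gk ->]]; right; apply/imset2P.
by exists a g; rewrite // H_forms_row' mg gk eqxx.
Qed.

Lemma dual_vector h g k : h 0 k = 1 -> g != g 0 k *: h ->
  exists x, lin_form h x = 0 /\ lin_form g x = 1.
Proof.
move=> hk; rewrite -subr_eq0 => p0.
have [i pi] : exists i, (g - g 0 k *: h) 0 i != 0.
  apply/existsP; apply: contraR p0 => /existsPn hi.
  by apply/eqP/rowP => i; have /negPn/eqP-> := hi i; rewrite mxE.
pose x : V := delta_mx 0 i + (- h 0 i) *: delta_mx 0 k.
have hx : lin_form h x = 0.
  by rewrite lin_formD lin_formZ !lin_form_delta hk mulr1 subrr.
have gx : lin_form g x = (g - g 0 k *: h) 0 i.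
  by rewrite lin_formD lin_formZ !lin_form_delta !mxE mulNr mulrC.
exists ((lin_form g x)^-1 *: x); rewrite !lin_formZ hx mulr0 mulVf //.
by rewrite gx.
Qed.

Lemma dual_monic h g : monic h -> monic g -> h != g ->
  exists x, lin_form h x = 0 /\ lin_form g x = 1.
Proof.
move=> mh mg hg; have /existsP[k /andP[_ /eqP hk]] := mh.
apply: (dual_vector hk); apply: contraNneq hg => e.
rewrite -[g]scale1r in e; have [_ ->] := monic_scale (oner_neq0 _) mg mh e.
exact/eqP.
Qed.

(** Translation of F^n by t w. *)
Definition shiftv w t x : V := x + t *: w.

Lemma shiftv_inj w t : injective (shiftv w t).
Proof. exact: addIr. Qed.

Lemma linf_shift h w t x : linf h (shiftv w t x) = linf h x + t * lin_form h w.
Proof. by rewrite !ffunE lin_formD lin_formZ. Qed.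

Lemma quad_shift h a g w t x : lin_form h w = 0 ->
  quad h a g (shiftv w t x) = quad h a g x + t * lin_form g w.
Proof.
by move=> hw; rewrite !ffunE !lin_formD !lin_formZ hw mulr0 addr0 addrA.
Qed.

Lemma neq_forms h g k : h 0 k = 1 -> g 0 k = 0 -> h != g.
Proof. by move=> hk gk; apply: contra_eqN hk => /eqP->; rewrite gk eq_sym oner_eq0. Qed.

(** The level combinations of two columns. *)
Definition pairf (f1 f2 : {ffun V -> F}) x := (f1 x, f2 x).

Lemma coll_pair_sym (f1 f2 : {ffun V -> F}) : coll (pairf f1 f2) = coll (pairf f2 f1).
Proof. by apply: coll_eq => x y; rewrite !xpair_eqE andbC. Qed.

(** Two columns are orthogonal if some translation direction w fixes the first and
    shifts the second, and some direction w1 shifts the first. *)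
Lemma coll_pair_shift (f1 f2 : {ffun V -> F}) w w1 :
  (forall t x, f1 (shiftv w t x) = f1 x) ->
  (forall t x, f2 (shiftv w t x) = f2 x + t) ->
  (forall t x, f1 (shiftv w1 t x) = f1 x + t) ->
  (coll (pairf f1 f2) * s ^ 2 = #|{: V}| ^ 2)%N.
Proof.
move=> e1 e2 e3; rewrite -(coll_balanced (@shiftv_inj w1) e3).
by rewrite -(coll_shift (@shiftv_inj w) e1 e2) -mulnA mulnn.
Qed.

Section OneForm.

Variables (h : V) (k : 'I_n).
Hypothesis hk : monic_at h k.

Let hk1 : h 0 k = 1. Proof. by have /andP[_ /eqP] := hk. Qed.
Let mh : monic h. Proof. by apply/existsP; exists k. Qed.

Lemma quad_dual g : monic g -> g 0 k = 0 ->
  exists w, lin_form h w = 0 /\ lin_form g w = 1.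
Proof. by move=> mg gk; apply: dual_monic => //; apply: neq_forms hk1 gk. Qed.

Lemma Q_of_shift f : f \in Q_of h ->
  exists w, forall t x, f (shiftv w t x) = f x + t.
Proof.
case/(Q_ofP _ hk) => [->|[a [g [mg gk ->]]]].
  by exists (delta_mx 0 k) => t x; rewrite linf_shift lin_form_delta hk1 mulr1.
have [w [hw gw]] := quad_dual mg gk.
by exists w => t x; rewrite quad_shift // gw mulr1.
Qed.

Lemma coll_linf_quad a g : monic g -> g 0 k = 0 ->
  (coll (pairf (linf h) (quad h a g)) * s ^ 2 = #|{: V}| ^ 2)%N.
Proof.
move=> mg gk; have [w [hw gw]] := quad_dual mg gk.
apply: (@coll_pair_shift _ _ w (delta_mx 0 k)) => t x.
- by rewrite linf_shift hw mulr0 addr0.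
- by rewrite quad_shift // gw mulr1.
by rewrite linf_shift lin_form_delta hk1 mulr1.
Qed.

Lemma Q_of_orthogonal f1 f2 : f1 \in Q_of h -> f2 \in Q_of h -> f1 != f2 ->
  (coll (pairf f1 f2) * s ^ 2 = #|{: V}| ^ 2)%N.
Proof.
move=> /(Q_ofP _ hk)[->|[a [g [mg gk ->]]]] /(Q_ofP _ hk)[->|[b [g' [mg' gk' ->]]]].
- by rewrite eqxx.
- by move=> _; apply: coll_linf_quad.
- by move=> _; rewrite coll_pair_sym; apply: coll_linf_quad.
have [<-|gg' _] := eqVneq g g'.
  have [<-|ab _] := eqVneq a b; first by rewrite eqxx.
  rewrite -(coll_linf_quad a mg gk); congr (_ * _)%N; apply: coll_eq => x y.
  rewrite !xpair_eqE !ffunE.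
  apply/andP/andP => -[/eqP e1 /eqP e2].
    split; last by rewrite e1.
    pose Q t z := lin_form h z ^+ 2 + t * lin_form h z + lin_form g z.
    have : (a - b) * (lin_form h x - lin_form h y) = 0.
      transitivity ((Q a x - Q a y) - (Q b x - Q b y)); first by rewrite /Q; ring.
      by rewrite /Q e1 e2 !subrr.
    by move/eqP; rewrite mulf_eq0 !subr_eq0 (negbTE ab).
  have eg : lin_form g x = lin_form g y by move: e2; rewrite e1 => /addrI.
  by rewrite e1 eg.
have [x [gx gx']] := dual_monic mg mg' gg'.
(* Moving along the k-th axis corrects the value of h and does not affect g and
   g', which do not involve X_k. *)
pose w : V := shiftv (delta_mx 0 k) (- lin_form h x) x.
have hw : lin_form h w = 0.
  by rewrite lin_formD lin_formZ lin_form_delta hk1 mulr1 subrr.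
have gw : lin_form g w = 0.
  by rewrite lin_formD lin_formZ lin_form_delta gk mulr0 addr0.
have gw' : lin_form g' w = 1.
  by rewrite lin_formD lin_formZ lin_form_delta gk' mulr0 addr0.
have [w1 [hw1 gw1]] := quad_dual mg gk.
apply: (@coll_pair_shift _ _ w w1) => t y; rewrite quad_shift //.
- by rewrite gw mulr0 addr0.
- by rewrite gw' mulr1.
by rewrite gw1 mulr1.
Qed.

Lemma quad_inj a a' g g' : monic g -> monic g' -> g 0 k = 0 -> g' 0 k = 0 ->
  quad h a g = quad h a' g' -> a = a' /\ g = g'.
Proof.
move=> mg mg' gk gk' /ffunP e.
suff /rowP e' : a *: h + g = a' *: h + g'.
  have aa' : a = a'.
    by have := e' k; rewrite !mxE hk1 gk gk' !mulr1 !addr0.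
  by split=> //; apply: (@addrI _ (a *: h)); rewrite {2}aa'; apply/rowP.
apply: lin_form_inj => x; rewrite !lin_formDl !lin_formZl.
by have := e x; rewrite !ffunE -!addrA => /addrI.
Qed.

Lemma linf_neq_quad a g : monic g -> g 0 k = 0 -> linf h != quad h a g.
Proof.
move=> mg gk; have [w [hw gw]] := quad_dual mg gk.
apply/eqP => /ffunP/(_ w); rewrite !ffunE hw gw.
by rewrite expr0n mulr0 !add0r => /esym/eqP; rewrite oner_eq0.
Qed.

Lemma card_Q_of : (#|Q_of h| * (s - 1) = s ^ n - 1)%N.
Proof.
have F_gt1 := finNzRing_gt1 F.
pose G := [set g : V | monic g & g 0 k == 0].
have -> : #|Q_of h| = (1 + s * #|G|)%N.
  have -> : Q_of h = linf h |: [set quad h p.1 p.2 | p in setX setT G].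
    apply/setP => f; rewrite in_setU1; apply/(Q_ofP _ hk)/orP.
      case=> [->|[a [g [mg gk ->]]]]; [by left | right].
      by apply/imsetP; exists (a, g); rewrite // !inE mg gk /=.
    case=> [/eqP->|/imsetP[[a g]]]; first by left.
    by rewrite !inE /= => /andP[mg /eqP gk] ->; right; exists a, g.
  rewrite cardsU1 card_in_imset.
    rewrite cardsX cardsT; congr (_ + _)%N; case: imsetP => // -[[a g]].
    rewrite !inE /= => /andP[mg /eqP gk] e.
    by have := linf_neq_quad a mg gk; rewrite e eqxx.
  move=> [a g] [b g']; rewrite !inE /= => /andP[mg /eqP gk] /andP[mg' /eqP gk'].
  by move/(quad_inj mg mg' gk gk') => [-> ->].
pose P0 := [set g : V | g 0 k == 0]; pose P := P0 :\ 0.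
have PE : (#|P| + 1 = #|P0|)%N.
  by rewrite [RHS](cardsD1 0) !inE mxE eqxx addnC.
have GE : (#|G| * (s - 1) = #|P|)%N.
  have notP0 : 0 \notin P by rewrite !inE eqxx.
  have PZ t g : t != 0 -> g \in P -> t *: g \in P.
    by move=> t0; rewrite !inE scaler_eq0 mxE mulf_eq0 (negbTE t0).
  rewrite -(card_monic notP0 PZ).
  congr (_ * _)%N; apply: eq_card => g; rewrite !inE andbC.
  by case mg: (monic g); rewrite ?andbF //= (monic_neq0 mg) andbT.
have := @card_level F V setT (fun t x => x + t *: delta_mx 0 k) (fun x => x 0 k)
  _ _ _ 0.
rewrite cardsT card_mx mul1n => E.
have {E} : (#|P0| * s = s ^ n)%N.
  rewrite -E.
  - by congr (_ * _)%N; apply: eq_card => g; rewrite !inE.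
  - by move=> t; apply: addIr.
  - by move=> t g _; rewrite inE.
  by move=> t g _; rewrite !mxE !eqxx mulr1.
rewrite -PE -GE => <-.
by nia.
Qed.

End OneForm.

End Forms.

(** * A column of Q_h1 against a column of Q_h2 *)

Section TwoForms.

Variables (F : finFieldType) (n : nat).
Local Notation s := #|F|.
Local Notation V := 'rV[F]_n.
Local Notation N := #|{: V}|.
Implicit Types (g x y w : V) (a b c t : F).

(** The form g vanishes on the common kernel of h1 and h2. *)
Definition vanish (h1 h2 g : V) : bool :=
  [forall x, (lin_form h1 x == 0) && (lin_form h2 x == 0) ==> (lin_form g x == 0)].

Lemma vanishP h1 h2 g :
  reflect (forall x, lin_form h1 x = 0 -> lin_form h2 x = 0 -> lin_form g x = 0)
          (vanish h1 h2 g).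
Proof.
apply: (iffP forallP) => [H x e1 e2|H x].
  by have := H x; rewrite e1 e2 eqxx /= => /eqP.
by apply/implyP => /andP[/eqP e1 /eqP e2]; rewrite H.
Qed.

Lemma vanishC h1 h2 g : vanish h1 h2 g = vanish h2 h1 g.
Proof. by apply: eq_forallb => x; rewrite andbC. Qed.

Lemma not_vanish h1 h2 g : ~~ vanish h1 h2 g ->
  exists z, [/\ lin_form h1 z = 0, lin_form h2 z = 0 & lin_form g z = 1].
Proof.
case/forallPn => x; rewrite negb_imply => /andP[/andP[/eqP e1 /eqP e2] gx].
by exists ((lin_form g x)^-1 *: x); rewrite !lin_formZ e1 e2 mulr0 mulVf.
Qed.

(** The form g may occur in a column h ^ 2 + a h + g of Q_h, k being the last
    index of h, and vanishes on the common kernel of h and h'. *)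
Definition special (h h' : V) (k : 'I_n) g := [&& monic g, g 0 k == 0 & vanish h h' g].

(** The points x and x' are dual to the pair h, h'.  A form vanishing on the common
    kernel is a combination of h and h', and the condition at the index k of h
    makes it a multiple of p. *)
Section Special.

Variables (h h' : V) (k : 'I_n) (x x' : V).
Hypotheses (hk : monic_at h k) (mh' : monic h') (hh' : h != h').
Hypotheses (hx : lin_form h x = 1) (h'x : lin_form h' x = 0).
Hypotheses (hx' : lin_form h x' = 0) (h'x' : lin_form h' x' = 1).

Let mh : monic h. Proof. by apply/existsP; exists k. Qed.
Let hk1 : h 0 k = 1. Proof. by have /andP[_ /eqP] := hk. Qed.
Let p := h' - h' 0 k *: h.

Lemma vanishE g : vanish h h' g -> g = lin_form g x *: h + lin_form g x' *: h'.
Proof.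
move/vanishP => gZ; apply: lin_form_inj => y; rewrite lin_formDl !lin_formZl.
pose z := y + ((- lin_form h y) *: x + (- lin_form h' y) *: x').
have : lin_form g z = 0.
  apply: gZ; rewrite !lin_formD !lin_formZ ?hx ?h'x ?hx' ?h'x'; ring.
rewrite !lin_formD !lin_formZ => /eqP; rewrite addr_eq0 => /eqP->; ring.
Qed.

Lemma lin_form_vanish g y : vanish h h' g ->
  lin_form g y = lin_form g x * lin_form h y + lin_form g x' * lin_form h' y.
Proof. by move/vanishE => {1}->; rewrite lin_formDl !lin_formZl. Qed.

Lemma special_multiple g : special h h' k g -> g = lin_form g x' *: p.
Proof.
case/and3P => mg /eqP gk /vanishE gE.
have e : lin_form g x = - (lin_form g x' * h' 0 k).
  move/rowP/(_ k): gE; rewrite gk !mxE hk1 mulr1 => /esym/eqP.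
  by rewrite addr_eq0 => /eqP.
by rewrite {1}gE e /p scalerBr scalerA scaleNr addrC.
Qed.

Lemma special_coef_neq0 g : special h h' k g -> lin_form g x' != 0.
Proof.
move=> sg; have /and3P[/monic_neq0 + _ _] := sg; apply: contraNneq => e.
by rewrite (special_multiple sg) e scale0r.
Qed.

Lemma special_exists : exists g, special h h' k g.
Proof.
have p0 : p != 0.
  rewrite subr_eq0; apply: contraNneq hh' => e.
  rewrite -[h']scale1r in e; have [_ ->] := monic_scale (oner_neq0 _) mh' mh e.
  exact/eqP.
have [t t0 mt] := monic_multiple p0; exists (t *: p); apply/and3P; split=> //.
  by rewrite !mxE hk1 mulr1 subrr mulr0.
apply/vanishP => y e1 e2; rewrite lin_formZl lin_formDl e2 -scaleNr lin_formZl e1.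
by rewrite mulr0 addr0 mulr0.
Qed.

Lemma special_uniq g g' : special h h' k g -> special h h' k g' -> g = g'.
Proof.
move=> sg sg'; have t0 := special_coef_neq0 sg'.
have /and3P[mg _ _] := sg; have /and3P[mg' _ _] := sg'.
have [] // := @monic_scale _ _ g g' (lin_form g' x') (lin_form g x') t0 mg mg'.
by rewrite {1}(special_multiple sg) {2}(special_multiple sg') !scalerA mulrC.
Qed.

End Special.

(** The h2-coefficient of g1 and the h1-coefficient of g2 are both 1, or opposite;
    in characteristic two they are equal. *)
Section SpecialCoef.

Variables (h1 h2 : V) (k1 k2 : 'I_n) (x1 x2 : V) (g1 g2 : V).
Hypotheses (h1k : monic_at h1 k1) (h2k : monic_at h2 k2).
Hypotheses (h1x1 : lin_form h1 x1 = 1) (h2x1 : lin_form h2 x1 = 0).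
Hypotheses (h1x2 : lin_form h1 x2 = 0) (h2x2 : lin_form h2 x2 = 1).
Hypotheses (sg1 : special h1 h2 k1 g1) (sg2 : special h2 h1 k2 g2).

Lemma special_coef_lt : (k1 < k2)%N ->
  lin_form g1 x2 = 1 /\ lin_form g2 x1 = 1.
Proof.
move=> k12; have /andP[/last_nonzeroP[_ h1j] /eqP h1k1] := h1k.
have /andP[/last_nonzeroP[_ h2j] /eqP h2k2] := h2k.
have m1 : monic h1 by apply/existsP; exists k1.
have /and3P[mg1 _ _] := sg1; have /and3P[mg2 _ _] := sg2.
have e1 := special_multiple h1k h1x1 h2x1 h1x2 h2x2 sg1.
have e2 := special_multiple h2k h2x2 h1x2 h2x1 h1x1 sg2.
split.
  have mp : monic (h2 - h2 0 k1 *: h1).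
    apply/existsP; exists k2; apply/andP; split.
      apply/last_nonzeroP; split=> [|j k2j]; rewrite !mxE.
        by rewrite h1j // mulr0 subr0 h2k2 oner_eq0.
      by rewrite (h2j j k2j) (h1j j (ltn_trans k12 k2j)) mulr0 subr0.
    by rewrite !mxE h1j // mulr0 subr0 h2k2.
  by rewrite -{1}[g1]scale1r in e1; have [<-] := monic_scale (oner_neq0 _) mg1 mp e1.
rewrite h1j // scale0r subr0 -{1}[g2]scale1r in e2.
by have [<-] := monic_scale (oner_neq0 _) mg2 m1 e2.
Qed.

Lemma special_coef_eq : k1 = k2 -> lin_form g2 x1 = - lin_form g1 x2.
Proof.
move=> k12; have /andP[_ /eqP h1k1] := h1k; have /andP[_ /eqP h2k2] := h2k.
have /and3P[mg1 _ _] := sg1; have /and3P[mg2 _ _] := sg2.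
have e1 := special_multiple h1k h1x1 h2x1 h1x2 h2x2 sg1.
have e2 := special_multiple h2k h2x2 h1x2 h2x1 h1x1 sg2.
have c2 := special_coef_neq0 h2k h2x2 h1x2 h2x1 h1x1 sg2.
have [] // := @monic_scale _ _ g1 g2 (lin_form g2 x1) (- lin_form g1 x2) c2 mg1 mg2.
rewrite {1}e1 {2}e2 !scalerA k12 h2k2 -k12 h1k1 !scale1r mulNr mulrC scaleNr -scalerN.
by rewrite opprB.
Qed.

End SpecialCoef.

(** From here on g1 and g2 are the special forms for (h1, h2) and (h2, h1), and
    x1, x2 are points dual to h1, h2. *)
Section Cross.

Variables (h1 h2 : V) (k1 k2 : 'I_n) (x1 x2 : V) (g1 g2 : V).
Hypotheses (h1k : monic_at h1 k1) (h2k : monic_at h2 k2).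
Hypotheses (h1x1 : lin_form h1 x1 = 1) (h2x1 : lin_form h2 x1 = 0).
Hypotheses (h1x2 : lin_form h1 x2 = 0) (h2x2 : lin_form h2 x2 = 1).
Hypotheses (sg1 : special h1 h2 k1 g1) (sg2 : special h2 h1 k2 g2).

Let pi (x : V) : F * F := (lin_form h1 x, lin_form h2 x).

Lemma card_plane_fiber z : (#|[set x | pi x == z]| * #|{: F * F}| = N)%N.
Proof.
rewrite -[RHS]cardsT -(@card_level (F * F)%type V setT
  (fun (t : F * F) x => x + (t.1 *: x1 + t.2 *: x2)) pi _ _ _ z).
- by congr (_ * _)%N; apply: eq_card => x; rewrite !inE.
- by move=> t; apply: addIr.
- by move=> t x; rewrite !inE.
case=> t u x _; rewrite /pi !lin_formD !lin_formZ h1x1 h2x1 h1x2 h2x2.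
by rewrite !mulr0 !mulr1 addr0 add0r.
Qed.

Lemma coll_plane (U : finType) (f : F * F -> U) :
  (coll (f \o pi) * s ^ 4 = N ^ 2 * coll f)%N.
Proof.
by rewrite -(coll_factor f card_plane_fiber) card_prod mulnn -expnM.
Qed.

Lemma coll_linf_linf :
  (coll (pairf (linf h1) (linf h2)) * s ^ 2 = N ^ 2)%N.
Proof.
apply: (@coll_pair_shift _ _ _ _ x2 x1) => t x; rewrite linf_shift.
- by rewrite h1x2 mulr0 addr0.
- by rewrite h2x2 mulr1.
by rewrite h1x1 mulr1.
Qed.

Lemma coll_linf_special b :
  (coll (pairf (linf h1) (quad h2 b g2)) * s ^ 4
   = N ^ 2 * coll (plane1 (b + lin_form g2 x2)%R))%N.
Proof.
rewrite -coll_plane; congr (_ * _)%N; apply: coll_eq => x y.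
have /and3P[_ _ v2] := sg2; have gE := lin_form_vanish h2x2 h1x2 h2x1 h1x1 _ v2.
rewrite /pairf /plane1 /pi !xpair_eqE !ffunE /=; apply: andb_id2l => /eqP e.
rewrite (gE x) (gE y) e.
rewrite -[RHS](inj_eq (addIr (lin_form g2 x1 * lin_form h1 y))).
by congr (_ == _); ring.
Qed.

Lemma coll_linf_quad0 b g : monic g -> g 0 k2 = 0 -> ~~ vanish h2 h1 g ->
  (coll (pairf (linf h1) (quad h2 b g)) * s ^ 2 = N ^ 2)%N.
Proof.
move=> mg gk /not_vanish[z [h2z h1z gz]].
apply: (@coll_pair_shift _ _ _ _ z x1) => t x; rewrite ?linf_shift.
- by rewrite h1z mulr0 addr0.
- by rewrite quad_shift // gz mulr1.
by rewrite h1x1 mulr1.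
Qed.

Lemma coll_special_special a b :
  (coll (pairf (quad h1 a g1) (quad h2 b g2)) * s ^ 4
   = N ^ 2 * coll (plane2 (a + lin_form g1 x1)%R (b + lin_form g2 x2)%R
                          (lin_form g2 x1) (lin_form g1 x2)))%N.
Proof.
rewrite -coll_plane; congr (_ * _)%N; apply: coll_eq => x y.
have /and3P[_ _ v1] := sg1; have gE1 := lin_form_vanish h1x1 h2x1 h1x2 h2x2 _ v1.
have /and3P[_ _ v2] := sg2; have gE2 := lin_form_vanish h2x2 h1x2 h2x1 h1x1 _ v2.
suff E z : pairf (quad h1 a g1) (quad h2 b g2) z =
   (plane2 (a + lin_form g1 x1) (b + lin_form g2 x2) (lin_form g2 x1)
       (lin_form g1 x2) \o pi) z by rewrite !E.
rewrite /pairf /plane2 /pi !ffunE /= (gE1 z) (gE2 z).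
by congr (_, _); ring.
Qed.

(** The linear parts do not both vanish on the common kernel Z.  The columns are
    then orthogonal unless g' is a nonzero multiple c g of g on Z. *)
Lemma coll_quad_quad a b g g' :
  monic g -> g 0 k1 = 0 -> monic g' -> g' 0 k2 = 0 ->
  ~~ (vanish h1 h2 g && vanish h1 h2 g') ->
  (coll (pairf (quad h1 a g) (quad h2 b g')) * s ^ 2 = N ^ 2)%N \/
  exists c a' b', c != 0 /\
    (coll (pairf (quad h1 a g) (quad h2 b g')) * s ^ 5
     = N ^ 2 * coll (plane3 c a' b'))%N.
Proof.
move=> mg gk mg' gk' nv.
have m1 : monic h1 by apply/existsP; exists k1.
have m2 : monic h2 by apply/existsP; exists k2.
have h1k1 : h1 0 k1 = 1 by have /andP[_ /eqP] := h1k.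
have h2k2 : h2 0 k2 = 1 by have /andP[_ /eqP] := h2k.
have [w [h1w gw]] := dual_monic m1 mg (neq_forms h1k1 gk).
have [w' [h2w' gw']] := dual_monic m2 mg' (neq_forms h2k2 gk').
have [v|/not_vanish[z [h1z h2z gz]]] := boolP (vanish h1 h2 g).
  move: nv; rewrite v /= => /not_vanish[z [h1z h2z gz']]; left.
  have gz : lin_form g z = 0 by move/vanishP: v; apply.
  apply: (@coll_pair_shift _ _ _ _ z w) => t x; rewrite quad_shift //.
  - by rewrite gz mulr0 addr0.
  - by rewrite gz' mulr1.
  by rewrite gw mulr1.
pose c := lin_form g' z.
have [v|/not_vanish[z' [h1z' h2z' gz']]] := boolP (vanish h1 h2 (g' - c *: g)); last first.
  pose u := z' + (- lin_form g z') *: z; left.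
  have hu1 : lin_form h1 u = 0 by rewrite lin_formD lin_formZ h1z h1z' mulr0 addr0.
  have hu2 : lin_form h2 u = 0 by rewrite lin_formD lin_formZ h2z h2z' mulr0 addr0.
  have gu : lin_form g u = 0 by rewrite lin_formD lin_formZ gz mulr1 subrr.
  have gu' : lin_form g' u = 1.
    rewrite lin_formD lin_formZ -/c -gz' lin_formDl -scaleNr lin_formZl; ring.
  apply: (@coll_pair_shift _ _ _ _ u w) => t x; rewrite quad_shift //.
  - by rewrite gu mulr0 addr0.
  - by rewrite gu' mulr1.
  by rewrite gw mulr1.
have [c0|c0] := eqVneq c 0.
  left; rewrite coll_pair_sym.
  apply: (@coll_pair_shift _ _ _ _ z w') => t x; rewrite quad_shift //.
  - by rewrite -/c c0 mulr0 addr0.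
  - by rewrite gz mulr1.
  by rewrite gw' mulr1.
right; have gE := vanishE h1x1 h2x1 h1x2 h2x2 v.
set la := lin_form (g' - c *: g) x1 in gE.
set mu := lin_form (g' - c *: g) x2 in gE.
exists c, (c * a - la), (b + mu); split=> //.
pose f1 := quad h1 a g; pose f2 := quad h2 b g'.
pose phi x := f2 x - c * f1 x.
have phiE x : phi x = (plane3 c (c * a - la) (b + mu) \o pi) x.
  have := congr1 (fun q => lin_form q x) gE.
  rewrite !lin_formDl -scaleNr !lin_formZl => e.
  have {}e : lin_form g' x = la * lin_form h1 x + mu * lin_form h2 x + c * lin_form g x.
    by rewrite -e; ring.
  by rewrite /phi /f1 /f2 !ffunE /plane3 /pi /= e; ring.
(* Translation by z, along Z, shifts f1 and fixes phi = f2 - c f1. *)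
have -> : coll (pairf f1 f2) = coll (fun x => (phi x, f1 x)).
  apply: coll_eq => x y; rewrite !xpair_eqE [RHS]andbC.
  by apply: andb_id2l => /eqP e; rewrite /phi e (inj_eq (addIr _)).
rewrite (_ : 5 = 1 + 4)%N // expnD expn1 mulnA.
rewrite (coll_shift (tau := shiftv z)).
- by rewrite -coll_plane; congr (_ * _)%N; apply: coll_eq => x y; rewrite !phiE.
- exact: shiftv_inj.
- move=> t x; rewrite /phi /f1 /f2 !quad_shift // gz -/c; ring.
by move=> t x; rewrite quad_shift // gz mulr1.
Qed.

(** The possible positions of f1 in Q_h1 and f2 in Q_h2: orthogonal columns, one
    column a form and the other with special linear part, both linear parts
    special, or linear parts proportional on the common kernel. *)
Variant cross_spec (f1 f2 : {ffun V -> F}) : Prop :=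
| CrossZero of (coll (pairf f1 f2) * s ^ 2 = N ^ 2)%N
| CrossLinL b of f1 = linf h1 & f2 = quad h2 b g2
| CrossLinR a of f1 = quad h1 a g1 & f2 = linf h2
| CrossQuad a b of f1 = quad h1 a g1 & f2 = quad h2 b g2
| CrossProp c a b of c != 0 &
   (coll (pairf f1 f2) * s ^ 5 = N ^ 2 * coll (plane3 c a b))%N.

End Cross.

Section CrossCases.

Variables (h1 h2 : V) (k1 k2 : 'I_n) (x1 x2 : V) (g1 g2 : V).
Hypotheses (h1k : monic_at h1 k1) (h2k : monic_at h2 k2).
Hypotheses (h1x1 : lin_form h1 x1 = 1) (h2x1 : lin_form h2 x1 = 0).
Hypotheses (h1x2 : lin_form h1 x2 = 0) (h2x2 : lin_form h2 x2 = 1).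
Hypotheses (sg1 : special h1 h2 k1 g1) (sg2 : special h2 h1 k2 g2).

Lemma cross_cases f1 f2 : f1 \in Q_of h1 -> f2 \in Q_of h2 ->
  cross_spec h1 h2 g1 g2 f1 f2.
Proof.
have u1 := special_uniq h1k h1x1 h2x1 h1x2 h2x2 sg1.
have u2 := special_uniq h2k h2x2 h1x2 h2x1 h1x1 sg2.
move=> /(Q_ofP _ h1k)[->|[a [g [mg gk ->]]]] /(Q_ofP _ h2k)[->|[b [g' [mg' gk' ->]]]].
- by apply: CrossZero; apply: (@coll_linf_linf _ _ x1 x2).
- have [v|nv] := boolP (vanish h2 h1 g').
    by apply: (@CrossLinL h1 h2 g1 g2 _ _ b); rewrite // (u2 g') // /special mg' gk' eqxx.
  by apply: CrossZero; apply: (coll_linf_quad0 (x1 := x1) (k2 := k2)).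
- have [v|nv] := boolP (vanish h1 h2 g).
    by apply: (@CrossLinR h1 h2 g1 g2 _ _ a); rewrite // (u1 g) // /special mg gk eqxx.
  apply: CrossZero; rewrite coll_pair_sym.
  by apply: (coll_linf_quad0 (x1 := x2) (k2 := k1)).
have [/andP[v v']|nv] := boolP (vanish h1 h2 g && vanish h1 h2 g').
  apply: (@CrossQuad h1 h2 g1 g2 _ _ a b).
    by rewrite (u1 g) // /special mg gk eqxx.
  by rewrite (u2 g') // /special mg' gk' eqxx vanishC.
have [e|[c [a' [b' [c0 e]]]]] :=
  coll_quad_quad h1k h2k h1x1 h2x1 h1x2 h2x2 a b mg gk mg' gk' nv.
  exact: CrossZero.
exact: CrossProp c0 e.
Qed.

End CrossCases.

End TwoForms.

(** * Designs given by families of functions *)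

Lemma coll_reindex (T T' : finType) (U : eqType) (pi : T -> T') (f : T' -> U) :
  bijective pi -> coll (f \o pi) = coll f.
Proof.
case=> pi' piK pi'K; pose pp (p : T * T) := (pi p.1, pi p.2).
have ppI : injective pp by move=> [x y] [x' y'] [/(can_inj piK)-> /(can_inj piK)->].
rewrite /coll -(card_imset _ ppI); apply: eq_card => -[x y]; rewrite !inE.
apply/imsetP/idP => [[[x' y']]|e]; first by rewrite inE /= => e [-> ->].
by exists (pi' x, pi' y); rewrite ?inE /pp /= !pi'K.
Qed.

Lemma coin_row_mx (S : finType) (N m1 m2 : nat)
    (D1 : 'M[S]_(N, m1)) (D2 : 'M[S]_(N, m2)) i j :
  coin (row_mx D1 D2) i j = (coin D1 i j + coin D2 i j)%N.
Proof.
rewrite /coin -!sum1dep_card big_split_ord /=.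
by congr (_ + _)%N; apply: eq_bigl => k; rewrite ?row_mxEl ?row_mxEr.
Qed.

Lemma balanced_row_mx (S : finType) (N m1 m2 : nat)
    (D1 : 'M[S]_(N, m1)) (D2 : 'M[S]_(N, m2)) :
  balanced D1 -> balanced D2 -> balanced (row_mx D1 D2).
Proof.
move=> b1 b2 k x; case: (split_ordP k) => k' ->.
  rewrite -{}[RHS](b1 k' x); congr (_ * _)%N.
  by apply: eq_card => i; rewrite !inE row_mxEl.
rewrite -{}[RHS](b2 k' x); congr (_ * _)%N.
by apply: eq_card => i; rewrite !inE row_mxEr.
Qed.

Section PolyDesign.

Variables (F : finFieldType) (n : nat).
Local Notation V := 'rV[F]_n.
Implicit Types (A B : {set {ffun V -> F}}) (f : {ffun V -> F}).

Lemma poly_designE A i k : poly_design A i k = (enum_val k) (enum_val i).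
Proof. by rewrite mxE. Qed.

Lemma enum_rows_bij : bijective (fun i : 'I_#|{: V}| => (enum_val i : V)).
Proof. exact: enum_val_bij. Qed.

Lemma card_points : #|{: V}| = (#|F| ^ n)%N.
Proof. by rewrite card_mx mul1n. Qed.

Lemma poly_design_balanced A :
  (forall f, f \in A -> exists w, forall t x, f (shiftv w t x) = f x + t) ->
  balanced (poly_design A).
Proof.
move=> shA k v; have [w wP] := shA _ (enum_valP k).
rewrite -[RHS]cardsT -(@card_level _ V setT (shiftv w) (enum_val k) _ _ _ v).
- congr (_ * _)%N; rewrite -(card_imset _ enum_val_inj); apply: eq_card => x.
  rewrite !inE; apply/imsetP/idP => [[i]|fx].
    by rewrite inE poly_designE => ? ->.
  by exists (enum_rank x); rewrite ?inE ?poly_designE enum_rankK.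
- exact: shiftv_inj.
- by move=> t x; rewrite !inE.
by move=> t x _; apply: wP.
Qed.

Lemma col_coll_poly m (D : 'M[F]_(#|{: V}|, m)) k l f1 f2 :
  (forall i, D i k = f1 (enum_val i)) -> (forall i, D i l = f2 (enum_val i)) ->
  col_coll D k l = coll (pairf f1 f2).
Proof.
move=> e1 e2; rewrite -(coll_reindex (pairf f1 f2) enum_rows_bij).
by apply: coll_eq => i j; rewrite !e1 !e2.
Qed.

(** If P fails inside each of the two blocks of columns, the pairs satisfying P
    are pairs of functions, one in each family. *)
Lemma num_pairs_cross A B (P : 'I_(#|A| + #|B|) -> 'I_(#|A| + #|B|) -> bool)
    (X : {set {ffun V -> F} * {ffun V -> F}}) :
  (forall k l, k != l -> ~~ P (lshift _ k) (lshift _ l)) ->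
  (forall k l, k != l -> ~~ P (rshift _ k) (rshift _ l)) ->
  X \subset setX A B ->
  (forall k l, P (lshift _ k) (rshift _ l) = ((enum_val k, enum_val l) \in X)) ->
  num_pairs P = #|X|.
Proof.
move=> PL PR XAB PX; pose h (p : 'I_#|A| * 'I_#|B|) := (lshift #|B| p.1, rshift #|A| p.2).
pose h' (p : 'I_#|A| * 'I_#|B|) : {ffun V -> F} * {ffun V -> F} :=
  (enum_val p.1, enum_val p.2).
have hI : injective h 
  by move=> [a b] [a' b'] e; have /= -> := lshift_inj (congr1 fst e);
    have /= -> := rshift_inj (congr1 snd e).
have hI' : injective h' by move=> [a b] [a' b'] [/enum_val_inj-> /enum_val_inj->].
pose Y := [set p | h' p \in X].
have -> : #|X| = #|Y|.
  rewrite -(card_imset _ hI'); apply: eq_card => -[f1 f2].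
  apply/idP/imsetP => [fX|[p]]; last by rewrite inE => ? ->.
  have /setXP[f1A f2B] := subsetP XAB _ fX.
  exists (enum_rank_in f1A f1, enum_rank_in f2B f2).
    by rewrite inE /h' /= !enum_rankK_in.
  by rewrite /h' /= !enum_rankK_in.
rewrite /num_pairs -(card_imset _ hI); apply: eq_card => -[k l].
apply/idP/imsetP => [|[[a b]]]; last first.
  by rewrite !inE /h' /= -PX => Pab [-> ->]; rewrite Pab andbT /= ltn_addr.
rewrite inE /=; case: (split_ordP k) => k' ->; case: (split_ordP l) => l' ->.
- case: (eqVneq k' l') => [->|/PL/negbTE->]; last by rewrite andbF.
  by rewrite ltnn.
- by move=> /andP[_ Pkl]; exists (k', l'); rewrite // inE /h' -PX.
- by rewrite /= ltnNge ltnW // ltn_addr.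
case: (eqVneq k' l') => [->|/PR/negbTE->]; last by rewrite andbF.
by rewrite ltnn.
Qed.

End PolyDesign.

(** * The juxtaposition of Q_h1 and Q_h2 *)

Section Juxtaposition.

Variables (F : finFieldType) (C : numClosedFieldType).
Variable c : 'I_#|F|.-1 -> F -> C.
Hypothesis cP : orthonormal_contrasts c.
Variables (n : nat) (h1 h2 : 'rV[F]_n) (k1 k2 : 'I_n).
Hypotheses (h1k : monic_at h1 k1) (h2k : monic_at h2 k2).

Local Notation q := #|F|.
Local Notation s := (#|F|%:R : C).
Local Notation V := 'rV[F]_n.
Local Notation N := #|{: V}|.
Local Notation A := (Q_of h1).
Local Notation B := (Q_of h2).
Local Notation D1 := (poly_design A).
Local Notation D2 := (poly_design B).
Local Notation D := (row_mx D1 D2).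
Local Notation A2 := (projected_A2 c D).

Let q_gt0 : (0 < q)%N. Proof. exact: ltnW (finNzRing_gt1 F). Qed.
Let N_gt0 : (0 < N)%N. Proof. by rewrite card_points expn_gt0 q_gt0. Qed.
Let s0 : s != 0. Proof. by rewrite pnatr_eq0 -lt0n. Qed.
Let N0 : N%:R != 0 :> C. Proof. by rewrite pnatr_eq0 -lt0n. Qed.

Lemma one_block_balanced (h : V) k : monic_at h k -> balanced (poly_design (Q_of h)).
Proof. by move=> hk; apply: poly_design_balanced => f; exact: (Q_of_shift hk). Qed.

Lemma one_block_coll (h : V) k a b : monic_at h k -> a != b ->
  (col_coll (poly_design (Q_of h)) a b * q ^ 2 = N ^ 2)%N.
Proof.
move=> hk ab; rewrite (@col_coll_poly _ _ _ _ a b (enum_val a) (enum_val b)).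
- by apply: (Q_of_orthogonal hk); rewrite ?enum_valP // (inj_eq enum_val_inj).
- by move=> i; rewrite poly_designE.
by move=> i; rewrite poly_designE.
Qed.

Lemma one_block_coin (h : V) k i j : monic_at h k -> i != j ->
  (q * coin (poly_design (Q_of h)) i j + 1 = #|Q_of h|)%N.
Proof.
move=> hk; apply: (@saturated_equidistant _ C) => //.
- exact: (one_block_balanced hk).
- by rewrite (card_Q_of hk) card_points.
by move=> a b ab; apply: (one_block_coll hk ab).
Qed.

Lemma design_balanced : balanced D.
Proof.
by apply: balanced_row_mx;
  [exact: (one_block_balanced h1k) | exact: (one_block_balanced h2k)].
Qed.
Let bD := design_balanced.

Lemma design_coin i j : i != j -> (q * coin D i j + 2 = #|A| + #|B|)%N.
Proof.
move=> ij; have e1 := one_block_coin h1k ij; have e2 := one_block_coin h2k ij.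
by rewrite coin_row_mx; lia.
Qed.

Lemma design_columns : ((#|A| + #|B|) * (q - 1) = 2 * (N - 1))%N.
Proof. by rewrite mulnDl (card_Q_of h1k) (card_Q_of h2k) card_points addnn mul2n. Qed.

Lemma design_A2 : gwlp c D 2 = N%:R - 1.
Proof.
apply: (equidistant_gwlp2 cP N_gt0 q_gt0 bD design_columns).
exact: design_coin.
Qed.

Lemma design_GMA : GMA_optimal c D.
Proof.
apply: (@equidistant_GMA _ _ c cP _ _ ((#|A| + #|B| - 2) %/ q) D N_gt0 q_gt0 bD) => i j ij.
have := design_coin ij; move: (coin D i j) => d E.
by rewrite -E addnK mulKn.
Qed.

(** The projected A_2 value of two balanced functions on F^n. *)
Definition pair_A2 (f1 f2 : {ffun V -> F}) : C :=
  s ^+ 2 * (coll (pairf f1 f2))%:R / N%:R ^+ 2 - 1.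

Lemma pair_A2_coll f1 f2 e j : (coll (pairf f1 f2) * q ^ (j + 2) = N ^ 2 * e)%N ->
  pair_A2 f1 f2 = e%:R / s ^+ j - 1.
Proof.
move/(congr1 (GRing.natmul (1 : C))); rewrite !natrM !natrX exprD => E.
rewrite /pair_A2; congr (_ - 1); apply: (mulIf (expf_neq0 j s0)).
rewrite mulfVK ?expf_neq0 //; apply: (mulIf (expf_neq0 2 N0)).
by rewrite [RHS]mulrC -E; field; rewrite N0.
Qed.

Lemma pair_A2_zero f1 f2 : (coll (pairf f1 f2) * q ^ 2 = N ^ 2)%N -> pair_A2 f1 f2 = 0.
Proof.
by move=> e; rewrite (@pair_A2_coll _ _ 1 0) ?muln1 // expr0 divr1 subrr.
Qed.

Lemma A2_left k l : k != l -> A2 (lshift _ k) (lshift _ l) = 0.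
Proof.
move=> kl; rewrite (projected_A2E cP N_gt0 q_gt0 bD).
rewrite (@col_coll_poly _ _ _ _ _ _ (enum_val k) (enum_val l)).
- apply: pair_A2_zero; apply: (Q_of_orthogonal h1k); rewrite ?enum_valP //.
  by rewrite (inj_eq enum_val_inj).
- by move=> i; rewrite row_mxEl poly_designE.
by move=> i; rewrite row_mxEl poly_designE.
Qed.

Lemma A2_right k l : k != l -> A2 (rshift _ k) (rshift _ l) = 0.
Proof.
move=> kl; rewrite (projected_A2E cP N_gt0 q_gt0 bD).
rewrite (@col_coll_poly _ _ _ _ _ _ (enum_val k) (enum_val l)).
- apply: pair_A2_zero; apply: (Q_of_orthogonal h2k); rewrite ?enum_valP //.
  by rewrite (inj_eq enum_val_inj).
- by move=> i; rewrite row_mxEr poly_designE.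
by move=> i; rewrite row_mxEr poly_designE.
Qed.

Lemma A2_cross k l : A2 (lshift _ k) (rshift _ l) = pair_A2 (enum_val k) (enum_val l).
Proof.
rewrite (projected_A2E cP N_gt0 q_gt0 bD).
by rewrite (@col_coll_poly _ _ _ _ _ _ (enum_val k) (enum_val l)) // => i;
  rewrite ?row_mxEl ?row_mxEr poly_designE.
Qed.

(** The values on distinct columns: 0 inside a block, otherwise the value for a
    column of each block. *)
Lemma A2_cases (P : C -> Prop) : P 0 ->
  (forall f1 f2, f1 \in A -> f2 \in B -> P (pair_A2 f1 f2)) ->
  forall k l, k <> l -> P (A2 k l).
Proof.
move=> P0 Pf k l; case: (split_ordP k) => k' ->; case: (split_ordP l) => l' -> kl.
- by rewrite A2_left //; apply: contra_notN kl => /eqP->.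
- by rewrite A2_cross; apply: Pf; apply: enum_valP.
- by rewrite projected_A2C // A2_cross; apply: Pf; apply: enum_valP.
by rewrite A2_right //; apply: contra_notN kl => /eqP->.
Qed.

Lemma num_pairs_A2 (P : pred C) (X : {set {ffun V -> F} * {ffun V -> F}}) :
  ~~ P 0 -> X \subset setX A B ->
  (forall f1 f2, f1 \in A -> f2 \in B -> P (pair_A2 f1 f2) = ((f1, f2) \in X)) ->
  num_pairs (fun k l => P (A2 k l)) = #|X|.
Proof.
move=> P0 XAB PX; apply: num_pairs_cross => // k l.
- by move=> kl; rewrite A2_left.
- by move=> kl; rewrite A2_right.
by rewrite A2_cross PX ?enum_valP.
Qed.

Lemma orthogonal_columns_A2 k l : orthogonal_columns D k l = (A2 k l == 0).
Proof.
rewrite (orthogonal_columnsE D k l N_gt0 q_gt0) (projected_A2E cP N_gt0 q_gt0 bD).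
rewrite subr_eq0 -(eqr_nat C) natrM !natrX.
rewrite -[RHS](inj_eq (mulIf (expf_neq0 2 N0))) mulfVK ?expf_neq0 // mul1r.
by rewrite mulrC.
Qed.

Lemma fully_aliased_A2 k l : fully_aliased D k l = (A2 k l == s - 1).
Proof.
rewrite (fully_aliasedE k l N_gt0 q_gt0 bD) (projected_A2E cP N_gt0 q_gt0 bD).
rewrite (inj_eq (addIr _)) -(eqr_nat C) natrM natrX.
rewrite -[RHS](inj_eq (mulIf (expf_neq0 2 N0))) mulfVK ?expf_neq0 //.
by rewrite expr2 -mulrA (inj_eq (mulfI s0)) mulrC.
Qed.

Lemma sum_A2 : \sum_(p : 'I_(#|A| + #|B|) * 'I_(#|A| + #|B|) | (p.1 < p.2)%N)
   A2 p.1 p.2 = N%:R - 1.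
Proof. by rewrite -gwlp2_sum // design_A2. Qed.

Lemma sum_num_pairs m (P : 'I_m -> 'I_m -> bool) (v : C) :
  \sum_(p : 'I_m * 'I_m | (p.1 < p.2)%N) v * (P p.1 p.2)%:R = v * (num_pairs P)%:R.
Proof.
rewrite -mulr_sumr; congr (_ * _); rewrite /num_pairs -sum1dep_card natr_sum.
rewrite [RHS]big_mkcondr; apply: eq_bigr => p _.
by case: (P _ _).
Qed.

End Juxtaposition.

(** * The projected A_2 values *)

(** The values that occur for odd s, and the value s - 1 of fully aliased columns,
    compared after multiplication by s ^ 2. *)
Lemma odd_values_distinct (C : numFieldType) (q : nat) (s := q%:R : C)
    (v1 := (s - 1) / s) (v2 := (s - 1) ^+ 2 / s ^+ 2) (v3 := (s - 1) / s ^+ 2) :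
  (2 < q)%N ->
  [/\ [/\ v1 != 0, v2 != 0 & v3 != 0], [/\ v1 != v2, v1 != v3 & v2 != v3]
    & [/\ s - 1 != 0, v1 != s - 1, v2 != s - 1 & v3 != s - 1]].
Proof.
move=> q_gt2; have q_gt0 : (0 < q)%N by apply: leq_trans q_gt2.
have s0 : s != 0 by rewrite pnatr_eq0 -lt0n.
have inj (e e' : nat) (v v' : C) :
    v * s ^+ 2 = e%:R -> v' * s ^+ 2 = e'%:R -> (v == v') = (e == e').
  move=> ve ve'; rewrite -(inj_eq (mulIf (expf_neq0 2 s0))) ve ve'.
  by rewrite eqr_nat.
have v0E : 0 * s ^+ 2 = 0%N%:R by rewrite mul0r.
have v1E : v1 * s ^+ 2 = (q * (q - 1))%N%:R.
  by rewrite natrM natrB /v1 ?/s //; field; rewrite -/s s0.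
have v2E : v2 * s ^+ 2 = ((q - 1) ^ 2)%N%:R.
  by rewrite natrX natrB /v2 ?/s //; field; rewrite -/s s0.
have v3E : v3 * s ^+ 2 = (q - 1)%N%:R.
  by rewrite natrB /v3 ?/s //; field; rewrite -/s s0.
have v4E : (s - 1) * s ^+ 2 = ((q - 1) * q ^ 2)%N%:R.
  by rewrite natrM natrX natrB.
rewrite (inj _ _ _ _ v1E v0E) (inj _ _ _ _ v2E v0E) (inj _ _ _ _ v3E v0E).
rewrite (inj _ _ _ _ v1E v2E) (inj _ _ _ _ v1E v3E) (inj _ _ _ _ v2E v3E).
rewrite (inj _ _ _ _ v4E v0E) (inj _ _ _ _ v1E v4E) (inj _ _ _ _ v2E v4E).
rewrite (inj _ _ _ _ v3E v4E).
have [p ->] : exists p, q = p.+3 by exists (q - 3)%N; lia.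
by split; split; apply/eqP; nia.
Qed.

Section Values.

Variables (F : finFieldType) (C : numClosedFieldType).
Variables (n : nat) (h1 h2 : 'rV[F]_n) (k1 k2 : 'I_n) (x1 x2 g1 g2 : 'rV[F]_n).
Hypotheses (h1k : monic_at h1 k1) (h2k : monic_at h2 k2).
Hypotheses (h1x1 : lin_form h1 x1 = 1) (h2x1 : lin_form h2 x1 = 0).
Hypotheses (h1x2 : lin_form h1 x2 = 0) (h2x2 : lin_form h2 x2 = 1).
Hypotheses (sg1 : special h1 h2 k1 g1) (sg2 : special h2 h1 k2 g2).
Hypothesis q_gt2 : (2 < #|F|)%N.

Local Notation q := #|F|.
Local Notation s := (#|F|%:R : C).
Local Notation V := 'rV[F]_n.
Local Notation N := #|{: V}|.
Local Notation A := (Q_of h1).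
Local Notation B := (Q_of h2).
Local Notation pair_A2 := (@pair_A2 F C n).

Let s0 : s != 0. Proof. by rewrite pnatr_eq0 -lt0n (ltn_trans _ q_gt2). Qed.

(** The pairs formed by the form h1 or h2 and a column with special linear part. *)
Definition lin_pairs : {set {ffun V -> F} * {ffun V -> F}} :=
  [set (linf h1, quad h2 b g2) | b : F] :|: [set (quad h1 a g1, linf h2) | a : F].

(** The pairs of columns both of which have a special linear part. *)
Definition quad_pairs : {set {ffun V -> F} * {ffun V -> F}} :=
  [set (quad h1 p.1 g1, quad h2 p.2 g2) | p : F * F].

Let mg1 : monic g1. Proof. by have /and3P[] := sg1. Qed.
Let mg2 : monic g2. Proof. by have /and3P[] := sg2. Qed.
Let g1k : g1 0 k1 = 0. Proof. by have /and3P[_ /eqP] := sg1. Qed.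
Let g2k : g2 0 k2 = 0. Proof. by have /and3P[_ /eqP] := sg2. Qed.

Let linA : linf h1 \in A. Proof. by apply/(Q_ofP _ h1k); left. Qed.
Let linB : linf h2 \in B. Proof. by apply/(Q_ofP _ h2k); left. Qed.
Let quadA a : quad h1 a g1 \in A.
Proof. by apply/(Q_ofP _ h1k); right; exists a, g1. Qed.
Let quadB b : quad h2 b g2 \in B.
Proof. by apply/(Q_ofP _ h2k); right; exists b, g2. Qed.

Let quadI1 : injective (fun a => quad h1 a g1).
Proof. by move=> a a' /(quad_inj h1k mg1 mg1 g1k g1k)[]. Qed.
Let quadI2 : injective (fun b => quad h2 b g2).
Proof. by move=> a a' /(quad_inj h2k mg2 mg2 g2k g2k)[]. Qed.

Lemma lin_pairs_sub : lin_pairs \subset setX A B.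
Proof.
by apply/subsetP => p /setUP[]/imsetP[a _ ->]; rewrite inE /= ?linA ?linB ?quadA ?quadB.
Qed.

Lemma quad_pairs_sub : quad_pairs \subset setX A B.
Proof. by apply/subsetP => p /imsetP[a _ ->]; rewrite inE /= quadA quadB. Qed.

Lemma card_lin_pairs : #|lin_pairs| = (2 * q)%N.
Proof.
rewrite cardsU !card_imset; last 2 first.
- by move=> a a' [/quadI1].
- by move=> a a' [/quadI2].
rewrite (_ : _ :&: _ = set0) ?cards0 ?subn0 ?addnn ?mul2n //.
apply/setP => p; rewrite !inE; apply/andP => -[/imsetP[b _ ->] /imsetP[a _ [e _]]].
by have := linf_neq_quad h1k a mg1 g1k; rewrite e eqxx.
Qed.

Lemma card_quad_pairs : #|quad_pairs| = (q ^ 2)%N.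
Proof.
rewrite card_imset; last by move=> [a b] [a' b'] [/quadI1-> /quadI2->].
by rewrite card_prod mulnn.
Qed.

Lemma coll_lin_pairs f1 f2 : (f1, f2) \in lin_pairs ->
  exists b : F, (coll (pairf f1 f2) * q ^ 4 = N ^ 2 * coll (plane1 b))%N.
Proof.
case/setUP => /imsetP[b _ [-> ->]].
  by eexists; exact: (coll_linf_special h1x1 h2x1 h1x2 h2x2 sg2 b).
by rewrite coll_pair_sym; eexists; exact: (coll_linf_special h2x2 h1x2 h2x1 h1x1 sg1 b).
Qed.

Lemma quad_pairsE a b : (quad h1 a g1, quad h2 b g2) \in quad_pairs.
Proof. by apply/imsetP; exists (a, b). Qed.

Let crossP := cross_cases h1k h2k h1x1 h2x1 h1x2 h2x2 sg1 sg2.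

Lemma cross_spec_sets f1 f2 : f1 \in A -> f2 \in B ->
  [\/ pair_A2 f1 f2 = 0, (f1, f2) \in lin_pairs, (f1, f2) \in quad_pairs |
   exists c a b : F, c != 0 /\
   (coll (pairf f1 f2) * q ^ 5 = N ^ 2 * coll (plane3 c a b))%N].
Proof.
move=> f1A f2B; case: (crossP f1A f2B) => [e|b -> ->|a -> ->|a b -> ->|c a b c0 e].
- by apply: Or41; apply: pair_A2_zero.
- by apply: Or42; rewrite inE; apply/orP; left; apply/imsetP; exists b.
- by apply: Or42; rewrite inE; apply/orP; right; apply/imsetP; exists a.
- by apply: Or43; apply: quad_pairsE.
by apply: Or44; exists c, a, b.
Qed.

Section OddValues.

Hypothesis two0 : 2 != 0 :> F.

Lemma pair_A2_lin_odd f1 f2 : (f1, f2) \in lin_pairs -> pair_A2 f1 f2 = (s - 1) / s.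
Proof.
case/coll_lin_pairs => b; rewrite coll_plane1_odd // => /(@pair_A2_coll F C n _ _ _ 2)->.
by rewrite natrM natrB ?natrM; [field; rewrite s0 | lia].
Qed.

Lemma pair_A2_quad_odd f1 f2 : (f1, f2) \in quad_pairs ->
  pair_A2 f1 f2 = (s - 1) ^+ 2 / s ^+ 2.
Proof.
case/imsetP => [[a b] _ [-> ->]] /=.
have E := coll_special_special h1x1 h2x1 h1x2 h2x2 sg1 sg2 a b.
rewrite coll_plane2_odd // in E.
- rewrite (@pair_A2_coll F C n _ _ _ 2 E) natrD !natrX natrB; first by field; rewrite s0.
  by lia.
- exact: (special_coef_neq0 h2k h2x2 h1x2 h2x1 h1x1 sg2).
exact: (special_coef_neq0 h1k h1x1 h2x1 h1x2 h2x2 sg1).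
Qed.

Lemma pair_A2_prop_odd f1 f2 (c a b : F) : c != 0 ->
  (coll (pairf f1 f2) * q ^ 5 = N ^ 2 * coll (plane3 c a b))%N ->
  pair_A2 f1 f2 = (s - 1) / s ^+ 2.
Proof.
move=> c0; rewrite coll_plane3_odd // => /(@pair_A2_coll F C n _ _ _ 3)->.
rewrite natrD natrM natrB ?natrX; first by field; rewrite s0.
by rewrite expn_gt0; lia.
Qed.

Local Notation v1 := ((s - 1) / s).
Local Notation v2 := ((s - 1) ^+ 2 / s ^+ 2).
Local Notation v3 := ((s - 1) / s ^+ 2).

Lemma odd_cases f1 f2 : f1 \in A -> f2 \in B ->
  [/\ [\/ pair_A2 f1 f2 = 0, pair_A2 f1 f2 = v1, pair_A2 f1 f2 = v2 | pair_A2 f1 f2 = v3],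
      (pair_A2 f1 f2 == v1) = ((f1, f2) \in lin_pairs)
    & (pair_A2 f1 f2 == v2) = ((f1, f2) \in quad_pairs)].
Proof.
have [[v10 v20 v30] [v12 v13 v23] _] := odd_values_distinct C q_gt2.
move=> f1A f2B; split.
- case: (cross_spec_sets f1A f2B)
    => [->|/pair_A2_lin_odd->|/pair_A2_quad_odd->|[c [a [b [c0 e]]]]].
  + by apply: Or41.
  + by apply: Or42.
  + by apply: Or43.
  by rewrite (pair_A2_prop_odd c0 e); apply: Or44.
- apply/idP/idP => [/eqP E|/pair_A2_lin_odd->//].
  case: (cross_spec_sets f1A f2B) => [e|//|/pair_A2_quad_odd e|[c [a [b [c0 e]]]]].
  + by rewrite -E e eqxx in v10.
  + by rewrite -E e eqxx in v12.
  by rewrite -E (pair_A2_prop_odd c0 e) eqxx in v13.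
apply/idP/idP => [/eqP E|/pair_A2_quad_odd->//].
case: (cross_spec_sets f1A f2B) => [e|/pair_A2_lin_odd e|//|[c [a [b [c0 e]]]]].
+ by rewrite -E e eqxx in v20.
+ by rewrite -E e eqxx in v12.
by rewrite -E (pair_A2_prop_odd c0 e) eqxx in v23.
Qed.

End OddValues.

Section EvenValues.

Hypothesis char2 : 2 = 0 :> F.

Lemma pair_A2_lin_even f1 f2 : (f1, f2) \in lin_pairs ->
  pair_A2 f1 f2 = 0 \/ pair_A2 f1 f2 = 1.
Proof.
case/coll_lin_pairs => b; rewrite (coll_plane1_even char2) => /(@pair_A2_coll F C n _ _ _ 2)->.
rewrite natrM natrX mulrAC mulfV ?mul1r ?expf_neq0 //.
by case: (b != 0); [right; rewrite (natrD _ 1 1) addrK | left; rewrite addn0 subrr].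
Qed.

Lemma pair_A2_prop_even f1 f2 (c a b : F) : c != 0 ->
  (coll (pairf f1 f2) * q ^ 5 = N ^ 2 * coll (plane3 c a b))%N ->
  pair_A2 f1 f2 = 0 \/ pair_A2 f1 f2 = 1.
Proof.
move=> c0; have [j -> j12] := coll_plane3_even char2 a b c0.
move=> /(@pair_A2_coll F C n _ _ _ 3)->.
rewrite natrM natrX mulrAC mulfV ?mul1r ?expf_neq0 //.
have [->|->] : j = 1%N \/ j = 2%N by lia.
  by left; rewrite subrr.
by right; rewrite (natrD _ 1 1) addrK.
Qed.

Let special_coef12 : lin_form g2 x1 = lin_form g1 x2.
Proof.
case: (ltngtP k1 k2) => [lt|gt|/val_inj e].
- by have [-> ->] := special_coef_lt h1k h2k h1x1 h2x1 h1x2 h2x2 sg1 sg2 lt.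
- by have [-> ->] := special_coef_lt h2k h1k h2x2 h1x2 h2x1 h1x1 sg2 sg1 gt.
rewrite (special_coef_eq h1k h2k h1x1 h2x1 h1x2 h2x2 sg1 sg2 e).
by apply/eqP; rewrite eq_sym -addr_eq0 -mulr2n -mulr_natl char2 mul0r.
Qed.

Let mu := lin_form g1 x2.
Let mu0 : mu != 0.
Proof. exact: (special_coef_neq0 h1k h1x1 h2x1 h1x2 h2x2 sg1). Qed.

Lemma pair_A2_quad_even a b :
  pair_A2 (quad h1 a g1) (quad h2 b g2) =
  #|quartic_roots (a + lin_form g1 x1) (b + lin_form g2 x2) mu mu|%:R - 1.
Proof.
have E := coll_special_special h1x1 h2x1 h1x2 h2x2 sg1 sg2 a b.
rewrite special_coef12 (coll_plane2_roots char2) // in E.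
rewrite (@pair_A2_coll F C n _ _ _ 2 E) natrM natrX mulrAC mulfV ?mul1r ?expf_neq0 //.
Qed.

Lemma even_cases f1 f2 : f1 \in A -> f2 \in B ->
  [\/ pair_A2 f1 f2 = 0, pair_A2 f1 f2 = 1 | pair_A2 f1 f2 = 3].
Proof.
move=> f1A f2B.
have c01 : pair_A2 f1 f2 = 0 \/ pair_A2 f1 f2 = 1 ->
    [\/ pair_A2 f1 f2 = 0, pair_A2 f1 f2 = 1 | pair_A2 f1 f2 = 3].
  by case=> ->; [apply: Or31 | apply: Or32].
case: (cross_spec_sets f1A f2B) => [->|/pair_A2_lin_even//||[c [a [b [c0 e]]]]].
- by apply: Or31.
- case/imsetP => [[a b] _ [-> ->]]; rewrite pair_A2_quad_even.
  have := card_quartic_roots char2 (a + lin_form g1 x1) (b + lin_form g2 x2) mu mu.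
  rewrite !inE => /or3P[]/eqP->.
  + by apply: Or31; rewrite subrr.
  + by apply: Or32; rewrite (natrD _ 1 1) addrK.
  by apply: Or33; rewrite (natrD _ 3 1) addrK.
by apply: c01; apply: pair_A2_prop_even e.
Qed.

(** For s = 4 exactly one pair reaches the value 3. *)
Lemma four_cases f1 f2 : q = 4%N -> f1 \in A -> f2 \in B ->
  (pair_A2 f1 f2 == 3) =
  ((f1, f2) \in [set (quad h1 (- lin_form g1 x1) g1, quad h2 (- lin_form g2 x2) g2)]).
Proof.
move=> q4 f1A f2B; rewrite inE.
have n3 (v : C) : v = 0 \/ v = 1 -> v <> 3.
  by case=> -> /eqP; rewrite eq_sym ?pnatr_eq0 // (eqr_nat _ 3 1).
apply/eqP/eqP => [E|[-> ->]]; last first.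
  rewrite pair_A2_quad_even !addNr.
  have /eqP-> : #|quartic_roots 0 0 mu mu| == 4%N.
    by rewrite (card_quartic_roots4 char2) // !eqxx.
  by rewrite (natrD _ 3 1) addrK.
case: (cross_spec_sets f1A f2B) => [e|/pair_A2_lin_even e||[c [a [b [c0 e]]]]].
- by case: (n3 _ (or_introl e)).
- by case: (n3 _ e).
- case/imsetP => [[a b] _ [e1 e2]]; move: E; rewrite e1 e2 pair_A2_quad_even => /eqP.
  rewrite subr_eq -(natrD _ 3 1) eqr_nat (card_quartic_roots4 char2) //.
  by rewrite !addr_eq0 => /andP[/eqP-> /eqP->].
by case: (n3 _ (pair_A2_prop_even c0 e)).
Qed.

End EvenValues.

End Values.

(** * Parity of the field size and the number of pairs *)

Lemma card_even_char2 (F : finFieldType) : ~~ odd #|F| -> 2 = 0 :> F.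
Proof.
move=> even_s; have := expf_card (-1 : F).
rewrite -signr_odd (negbTE even_s) expr0 => /eqP.
by rewrite -addr_eq0 => /eqP.
Qed.

Lemma card_odd_two_neq0 (F : finFieldType) : odd #|F| -> 2 != 0 :> F.
Proof. by move=> odd_s; apply: contraL odd_s => /eqP; apply: char2_card_even. Qed.

Lemma even_values_distinct (C : numFieldType) (q : nat) : (4 < q)%N ->
  [/\ q%:R - 1 != 0 :> C, q%:R - 1 != 1 :> C & q%:R - 1 != 3 :> C].
Proof.
move=> q_gt4; have -> : q%:R - 1 = (q - 1)%N%:R :> C by rewrite natrB //; lia.
by rewrite pnatr_eq0 (eqr_nat _ _ 1) (eqr_nat _ _ 3); split; lia.
Qed.

Theorem theorem5 (F : finFieldType) (C : numClosedFieldType)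
    (c : 'I_#|F|.-1 -> F -> C) (n : nat) (h1 h2 : 'rV[F]_n) :
  let s := #|F| in
  let m := ((2 * (s ^ n - 1)) %/ (s - 1))%N in
  let D := row_mx (poly_design (Q_of h1)) (poly_design (Q_of h2)) in
  let A2 := projected_A2 c D in
  (2 < s)%N ->
  orthonormal_contrasts c ->
  h1 \in H_forms (1%:M : 'M[F]_n) ->
  h2 \in H_forms (1%:M : 'M[F]_n) ->
  h1 <> h2 ->
  [/\ is_SSD D (s ^ n) s m,
      gwlp c D 2 = (s ^ n)%:R - 1,
      GMA_optimal c D
    & odd s || (4 < s)%N -> forall k l, k <> l -> ~~ fully_aliased D k l]
  /\
  [/\ odd s ->
        [/\ forall k l, k <> l ->
              [\/ A2 k l = 0,
                  A2 k l = (s%:R - 1) / s%:R,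
                  A2 k l = (s%:R - 1) ^+ 2 / s%:R ^+ 2
                | A2 k l = (s%:R - 1) / s%:R ^+ 2],
            num_pairs (fun k l => A2 k l == (s%:R - 1) / s%:R) = (2 * s)%N,
            num_pairs (fun k l => A2 k l == (s%:R - 1) ^+ 2 / s%:R ^+ 2)
              = (s ^ 2)%N
          & num_pairs (fun k l => A2 k l == (s%:R - 1) / s%:R ^+ 2)
              = ((s ^ 2 * (s ^ n - s ^ 2)) %/ (s - 1))%N],
      ~~ odd s ->
        forall k l, k <> l ->
          [\/ A2 k l = 0, A2 k l = 1, A2 k l = 2 | A2 k l = 3]
    & s = 4%N ->
        [/\ forall k l, k <> l -> [\/ A2 k l = 0, A2 k l = 1 | A2 k l = 3],
            num_pairs (fully_aliased D) = 1%N,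
            num_pairs (partially_aliased D) = (4 ^ n - 4)%N,
            forall k l, k <> l -> fully_aliased D k l -> A2 k l = 3
          & forall k l, k <> l -> partially_aliased D k l -> A2 k l = 1]].
Proof.
move=> s m D A2 s_gt2 cP; rewrite !H_forms1 => m1 m2 /eqP h12.
have /existsP[k1 h1k] := m1; have /existsP[k2 h2k] := m2.
have [x2 [h1x2 h2x2]] := dual_monic m1 m2 h12.
have [x1 [h2x1 h1x1]] : exists x, lin_form h2 x = 0 /\ lin_form h1 x = 1.
  by apply: dual_monic; rewrite // eq_sym.
have [g1 sg1] := special_exists h1k m2 h12.
have [g2 sg2] : exists g, special h2 h1 k2 g.
  by apply: special_exists => //; rewrite eq_sym.
have s_gt0 : (0 < s)%N by apply: leq_trans s_gt2.
have s0 : s%:R != 0 :> C by rewrite pnatr_eq0 -lt0n.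
have NE : #|{: 'rV[F]_n}| = (s ^ n)%N by rewrite card_points.
have fullE := fully_aliased_A2 cP h1k h2k.
have orthE := orthogonal_columns_A2 cP h1k h2k.
have sumA2 : \sum_(p : 'I_(#|Q_of h1| + #|Q_of h2|) * 'I_(#|Q_of h1| + #|Q_of h2|)
    | (p.1 < p.2)%N) A2 p.1 p.2 = (s ^ n)%:R - 1.
  by rewrite -NE; exact: (sum_A2 cP h1k h2k).
have casesA2 := A2_cases cP h1k h2k.
have oddP := odd_cases C h1k h2k h1x1 h2x1 h1x2 h2x2 sg1 sg2 s_gt2.
have evenP := even_cases C h1k h2k h1x1 h2x1 h1x2 h2x2 sg1 sg2 s_gt2.
have evenA2 : ~~ odd s -> forall k l, k <> l ->
    [\/ A2 k l = 0, A2 k l = 1 | A2 k l = 3].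
  move=> /card_even_char2 char2.
  apply: (casesA2 (fun v => [\/ v = 0, v = 1 | v = 3])) => [|f1 f2 f1A f2B].
    by apply: Or31.
  exact: evenP.
have oddA2 : odd s -> forall k l, k <> l ->
    [\/ A2 k l = 0, A2 k l = (s%:R - 1) / s%:R,
        A2 k l = (s%:R - 1) ^+ 2 / s%:R ^+ 2 | A2 k l = (s%:R - 1) / s%:R ^+ 2].
  move=> /card_odd_two_neq0 two0.
  apply: (casesA2 (fun v => [\/ v = 0, v = (s%:R - 1) / s%:R,
     v = (s%:R - 1) ^+ 2 / s%:R ^+ 2 | v = (s%:R - 1) / s%:R ^+ 2])).
    by apply: Or41.
  by move=> f1 f2 f1A f2B; have [] := oddP two0 f1 f2 f1A f2B.
have [[v10 v20 v30] [v12 v13 v23] [v40 v14 v24 v34]] := odd_values_distinct C s_gt2.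
split; split.
- split=> //; last exact: (design_balanced h1k h2k).
  by rewrite /m -NE -(design_columns h1k h2k) mulnK // subn_gt0 ltnW.
- by rewrite -NE; apply: (design_A2 cP h1k h2k).
- exact: (design_GMA cP h1k h2k).
- move=> s_cond k l kl; rewrite fullE; apply/eqP => E.
  have [odd_s|even_s] := boolP (odd s).
    have := oddA2 odd_s k l kl; rewrite /A2 E => -[] /eqP e.
    + by rewrite e in v40.
    + by rewrite eq_sym e in v14.
    + by rewrite eq_sym e in v24.
    by rewrite eq_sym e in v34.
  rewrite (negbTE even_s) /= in s_cond.
  have [n0 n1 n3] := even_values_distinct C s_cond.
  have := evenA2 even_s k l kl; rewrite /A2 E => -[] /eqP e.
  + by rewrite e in n0.
  + by rewrite e in n1.
  by rewrite e in n3.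
- move=> odd_s; have two0 := card_odd_two_neq0 odd_s.
  have n1 : num_pairs (fun k l => A2 k l == (s%:R - 1) / s%:R) = (2 * s)%N.
    rewrite -(card_lin_pairs h1k h2k sg1 sg2).
    apply: (num_pairs_A2 cP h1k h2k (P := fun v => v == (s%:R - 1) / s%:R)).
    + by rewrite eq_sym.
    + exact: (lin_pairs_sub h1k h2k sg1 sg2).
    by move=> f1 f2 f1A f2B; have [] := oddP two0 f1 f2 f1A f2B.
  have n2 : num_pairs (fun k l => A2 k l == (s%:R - 1) ^+ 2 / s%:R ^+ 2) = (s ^ 2)%N.
    rewrite -(card_quad_pairs h1k h2k sg1 sg2).
    apply: (num_pairs_A2 cP h1k h2k (P := fun v => v == (s%:R - 1) ^+ 2 / s%:R ^+ 2)).
    + by rewrite eq_sym.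
    + exact: (quad_pairs_sub h1k h2k sg1 sg2).
    by move=> f1 f2 f1A f2B; have [] := oddP two0 f1 f2 f1A f2B.
  split=> //; first exact: oddA2.
  (* The values of all the pairs sum to N - 1, which gives the last number. *)
  set n3 := num_pairs _.
  have : (s%:R - 1) / s%:R * (2 * s)%N%:R + (s%:R - 1) ^+ 2 / s%:R ^+ 2 * (s ^ 2)%N%:R
      + (s%:R - 1) / s%:R ^+ 2 * n3%:R = (s ^ n)%:R - 1 :> C.
    rewrite -sumA2 -n1 -n2 /n3 -!sum_num_pairs -!big_split; apply: eq_bigr => -[k l] /= kl.
    have {}kl : k <> l by move=> e; rewrite e ltnn in kl.
    case: (oddA2 odd_s k l kl) => ->.
    + by rewrite ![0 == _]eq_sym (negbTE v10) (negbTE v20) (negbTE v30) !mulr0 !addr0.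
    + by rewrite eqxx (negbTE v12) (negbTE v13) !mulr0 !addr0 mulr1.
    + by rewrite eqxx eq_sym (negbTE v12) (negbTE v23) !mulr0 addr0 add0r mulr1.
    rewrite eqxx eq_sym (negbTE v13) eq_sym (negbTE v23).
    by rewrite !mulr0 !add0r mulr1.
  move=> E; have {}E : (n3 * (s - 1) + s ^ 4)%N%:R = (s ^ 2 * s ^ n)%N%:R :> C.
    rewrite natrD !natrM !natrX natrB //.
    move: E; rewrite natrM !natrX => /(canLR (subrK _)) <-.
    by field.
  move/eqP: E; rewrite eqr_nat => /eqP E.
  by rewrite mulnBr -E -expnD addnK mulnK // subn_gt0 ltnW.
- move=> even_s k l kl; case: (evenA2 even_s k l kl) => e.
  + exact: Or41.
  + exact: Or42.
  exact: Or44.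
move=> s4; have even_s : ~~ odd s by rewrite s4.
have char2 := card_even_char2 even_s.
have s41 : s%:R - 1 = 3 :> C by rewrite s4 (natrD _ 3 1) addrK.
have full3 k l : fully_aliased D k l = (A2 k l == 3) by rewrite fullE s41.
have part1 k l : k <> l -> partially_aliased D k l -> A2 k l = 1.
  move=> kl; rewrite /partially_aliased orthE full3 -/A2 => /andP[/eqP n0 /eqP n3].
  by case: (evenA2 even_s k l kl).
have nfull : num_pairs (fully_aliased D) = 1%N.
  transitivity (num_pairs (fun k l => A2 k l == 3)).
    by apply: eq_card => p; rewrite !inE full3.
  transitivity #|[set (quad h1 (- lin_form g1 x1) g1, quad h2 (- lin_form g2 x2) g2)]|.
    2: exact: cards1.
  apply: (num_pairs_A2 cP h1k h2k (P := fun v => v == 3)).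
  + by rewrite eq_sym pnatr_eq0.
  + rewrite sub1set; apply: (subsetP (quad_pairs_sub h1k h2k sg1 sg2)).
    exact: quad_pairsE.
  by move=> f1 f2 f1A f2B; rewrite (four_cases C h1k h2k h1x1 h2x1 h1x2 h2x2 sg1 sg2).
split=> //; first exact: evenA2.
- have : (num_pairs (partially_aliased D))%:R + 3 = (s ^ n)%:R - 1 :> C.
    transitivity (1 * (num_pairs (partially_aliased D))%:R
        + 3 * (num_pairs (fully_aliased D))%:R : C).
      by rewrite nfull mul1r mulr1.
    rewrite -sumA2.
    rewrite -!sum_num_pairs -big_split; apply: eq_bigr => -[k l] /= kl.
    have {}kl : k <> l by move=> e; rewrite e ltnn in kl.
    rewrite /partially_aliased orthE full3 -/A2.
    case: (evenA2 even_s k l kl) => ->.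
    + by rewrite eqxx eq_sym pnatr_eq0 !mulr0 addr0.
    + by rewrite oner_eq0 (eqr_nat _ 1 3) mulr1 mulr0 addr0.
    by rewrite eqxx andbF mulr0 add0r mulr1.
  move=> E; have {}E : (num_pairs (partially_aliased D) + 4)%N%:R = (s ^ n)%N%:R :> C.
    by rewrite -[RHS](subrK 1) -E (natrD _ _ 4) -addrA -(natrD _ 3 1).
  by move/eqP: E; rewrite eqr_nat s4 => /eqP <-; rewrite addnK.
by move=> k l _; rewrite full3 => /eqP.
Qed.
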